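(* Suppose conditions (i)-(iii) of the context hold. Consider the disturbed error system $$\dot{\tilde x}^{\mathrm d}(t)=-\bar\Gamma\bar\Lambda^\top(t)\bar\Lambda(t)\tilde x^{\mathrm d}(t)+\big(\bar\Gamma\bar\Lambda^\top(t)\bar\Delta_2-\bar\Delta_1\big)\delta(t)$$ with input $\delta(t)\in\mathbb R^r$ and performance output $z^{\mathrm{OE}}(t)=Q^{\mathrm{OE}}\bar\Lambda(t)\tilde x^{\mathrm d}(t)+W^{\mathrm{OE}}\delta(t)\in\mathbb R^p$, where $(W^{\mathrm{OE}})^\top W^{\mathrm{OE}}=I_r$ and $(Q^{\mathrm{OE}})^\top W^{\mathrm{OE}}=0$. Choose $\alpha>0$ as $$\underset{\alpha}{\mathrm{arg\,max}}\ \frac{\underline\iota_3(\alpha)}{\bar\iota_3(\alpha)},$$ with $\underline\iota_3$ and $\bar\iota_3$ the explicit quantities defined in the context. Fix the constant $c_2>0$ and solve the following semidefinite program in the scalar decision variables $c_1,\gamma_1,\gamma_2,\gamma$ (with $c_1,\gamma_1,\gamma_2>0$): $$\text{minimize }\gamma\quad\text{subject to}\quad\gamma>0,\quad\gamma_1-\gamma_2\ge0,\quad\begin{bmatrix}\Phi_{11}^{\mathrm{OE}}&\Phi_{12}\\ \Phi_{12}^\top&-\gamma_2I_{nN}\end{bmatrix}\le0,$$ with $\Phi_{11}^{\mathrm{OE}},\Phi_{12}$ as in the context. If this program is feasible, choose $\bar\Gamma$ such that $\sqrt{\gamma_1}I_{nN}\ge\bar\Gamma\ge\sqrt{\gamma_2}I_{nN}$.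 In such case, the disturbed error system with input $\delta$ and output $z^{\mathrm{OE}}$ has an $\mathcal L_2$-gain of at most $\sqrt\gamma$.
   Context: Setting. There are $n$ agents with an undirected time-dependent communication graph on $\{1,\dots,n\}$ with $n_e(t)$ edges; $D(t)\in\mathbb R^{n\times n_e(t)}$ is an oriented incidence matrix ($+1$ at the source, $-1$ at the sink of each edge, $0$ otherwise) and $L(t)=D(t)D^\top(t)$ is the Laplacian. Agent $i$ has a regressor $C_i(t)\in\mathbb R^{N_y\times N}$; $\bar C(t)=\mathrm{diag}(C_1(t),\dots,C_n(t))$ (block diagonal) and $$\bar\Lambda(t)=\begin{bmatrix}\bar C(t)\\ \sqrt\alpha\,D^\top(t)\otimes I_N\end{bmatrix},$$ with $\alpha>0$ the consensus gain and $\bar\Gamma=\mathrm{diag}(\Gamma_1,\dots,\Gamma_n)$, $\Gamma_i\in\mathbb R^{N\times N}$ symmetric, the gradient descent gain. The disturbance enters as $\dot\theta^{\mathrm d}=\Delta_1\delta$ with $\Delta_1\in\mathbb R^{N\times r}$, $x^{\mathrm d}=\mathbf 1_n\otimes\theta^{\mathrm d}$, $\bar\Delta_1=\mathbf 1_n\otimes\Delta_1$, $y^{\mathrm d}=\bar\Lambda x^{\mathrm d}+\bar\Delta_2\delta$ with $\bar\Delta_2\in\mathbb R^{(nN_y+Nn_e(t))\times r}$; the estimator is $\dot{\hat x}^{\mathrm d}=-\bar\Gamma\bar\Lambda^\top(\bar\Lambda\hat x^{\mathrm d}-y^{\mathrm d})$, and $\tilde x^{\mathrm d}=\hat x^{\mathrm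 d}-x^{\mathrm d}$. Also $Q^{\mathrm{OE}}\in\mathbb R^{p\times(nN_y+Nn_e(t))}$, $W^{\mathrm{OE}}\in\mathbb R^{p\times r}$. $\|\cdot\|$ is the Euclidean norm or the induced matrix norm. Conditions: (i) there are constants $T>0$, $\bar\iota_1\ge\underline\iota_1>0$, independent of $t$, with $\bar\iota_1I_N\ge\int_{t-T}^t\sum_{i=1}^nC_i^\top(s)C_i(s)\,\mathrm ds\ge\underline\iota_1I_N$ for all $t\ge T$. (ii) $\|C_i^\top(t)C_i(t)\|\le r_2$ for all $t\ge0$ and all $i$, with $r_2>0$. (iii) $\int_{t-T}^tL(s)\,\mathrm ds$, with the same $T$, has only one zero eigenvalue, and all remaining eigenvalues are bounded below by a constant $\underline\lambda>0$; and $\|L(t)\|\le r_3$ for all $t\ge0$, with $r_3>0$. Constants (depending on $\alpha$ and on $\bar\Gamma$ through $r_1$). $r_1=\|\bar\Gamma\|$, $r_4=r_2+\alpha r_3$, $$\bar\iota_2=Tr_4,\qquad \underline\iota_2=\min_{a\in\mathbb R^N,\ \|a\|^2\le1}\max\Big\{\alpha\underline\lambda(1-\|a\|^2),\ \frac{\underline\iota_1}{n}\|a\|^2-2r_2T\sqrt{\|a\|^2(1-\|a\|^2)}\Big\},$$ $$\varphi_1=\tfrac12r_1^2\bar\iota_2^2,\qquad \varphi_2=\tfrac14\big(\mathrm e^{2r_1\bar\iota_2}-1\big)-\tfrac12r_1\bar\iota_2,$$ $$\bar\iota_3=\Big(\sqrt{\bar\iota_2-\underline\iota_2+\varphi_2\underline\iota_2}+\sqrt{\bar\iota_2}\Big)^2,\qquad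 \underline\iota_3=\begin{cases}\left(\dfrac{\sqrt{\bar\iota_2-\underline\iota_2+\varphi_1\underline\iota_2}-\sqrt{\bar\iota_2}}{\varphi_1-1}\right)^2&\text{if }\varphi_1\ne1,\\[2mm] \dfrac{\underline\iota_2}{4\bar\iota_2}&\text{if }\varphi_1=1.\end{cases}$$ Matrices (block sizes $nN_y+Nn_e(t)$, $nN$, $p$, $r$): $$\Phi_{11}^{\mathrm{OE}}=\begin{bmatrix}\phi_{11}&0&(Q^{\mathrm{OE}})^\top&0\\0&-\frac{c_2\underline\iota_3}{2}I_{nN}&0&0\\Q^{\mathrm{OE}}&0&-I_p&W^{\mathrm{OE}}\\0&0&(W^{\mathrm{OE}})^\top&\phi_{44}\end{bmatrix},\qquad \Phi_{12}=\begin{bmatrix}0\\0\\0\\-\frac{2c_1}{\sqrt{c_2\underline\iota_3}}\bar\Delta_1^\top\end{bmatrix},$$ $$\phi_{11}=(-c_1+c_2T)I_{nN_y+Nn_e(t)},\qquad \phi_{44}=\frac{8c_2\bar\iota_3^2}{\underline\iota_3}\bar\Delta_1^\top\bar\Delta_1+\Big(c_1+\frac{8c_2\bar\iota_3^2r_4\gamma_1}{\underline\iota_3}\Big)\bar\Delta_2^\top\bar\Delta_2-\gamma I_r.$$ $\mathcal L_2$-gain: with $\|u\|_{\mathcal L_2}^2=\int_0^\infty u^\top(s)u(s)\,\mathrm ds$, a system $H$ mapping $\mathcal L_2$ inputs to $\mathcal L_2$ outputs has finite $\mathcal L_2$-gain if there are constants $g,b\ge0$ with $\|H(u)\|_{\mathcal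 L_2}\le g\|u\|_{\mathcal L_2}+b$ for all $u\in\mathcal L_2$; its $\mathcal L_2$-gain is the infimum of the $g$ for which such a $b$ exists.
   Formalization: In the case φ1 = 1 the lower constant ι3 is taken as (ι2)²/(4 ῑ2) with lower ι2, the limit of the general formula, instead of the printed ι2/(4 ῑ2); with the printed value the bound √γ on the L2-gain can fail. *)

(* Defs.v *)
From HB Require Import structures.
From mathcomp Require Export all_boot all_order all_algebra.
From mathcomp Require Export all_classical all_reals all_analysis.
From mathcomp Require Export mxtens.
Set Implicit Arguments.
Unset Strict Implicit.
Unset Printing Implicit Defensive.
Export Order.TTheory GRing.Theory Num.Theory.
Export numFieldNormedType.Exports.
Global Open Scope classical_set_scope.
Global Open Scope ring_scope.

Definition enorm (R : realType) (m : nat) (x : 'cV[R]_m) : R :=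
  Num.sqrt (\sum_i x i 0 ^+ 2).

(* Norm induced by [enorm]; the library's norm on matrices is the max norm. *)
Definition opnorm (R : realType) (m k : nat) (A : 'M[R]_(m, k)) : R :=
  sup [set enorm (A *m x) | x in [set x : 'cV[R]_k | enorm x <= 1]].

Definition psdmx (R : realType) (m : nat) (A : 'M[R]_m) : Prop :=
  A^T = A /\ forall x : 'cV[R]_m, 0 <= (x^T *m A *m x) 0 0.

(* Loewner order on symmetric matrices. *)
Definition lemx (R : realType) (m : nat) (A B : 'M[R]_m) : Prop :=
  psdmx (B - A).

(* diag(A_1, ..., A_n), with the index convention of the Kronecker product
   [*t] of the library, in which the left factor is the outer index. *)
Definition blkdiag (R : realType) (n a b : nat) (A : 'I_n -> 'M[R]_(a, b))
    : 'M[R]_(n * a, n * b) :=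
  \sum_i delta_mx i i *t A i.

(* The stacked matrix 1_n (x) A. *)
Definition stack1 (R : realType) (n a b : nat) (A : 'M[R]_(a, b))
    : 'M[R]_(n * a, b) :=
  castmx (erefl, mul1n b) ((const_mx 1 : 'cV[R]_n) *t A).

Definition mxint (R : realType) (a b : nat) (t0 t1 : R)
    (A : R -> 'M[R]_(a, b)) : 'M[R]_(a, b) :=
  \matrix_(i, j) \int[lebesgue_measure]_(s in `[t0, t1]) A s i j.

Definition measurable_mx (R : realType) (a b : nat) (A : R -> 'M[R]_(a, b))
    : Prop :=
  forall i j, measurable_fun (`[0, +oo[ : set R) (fun t => A t i j).

(* Same for a matrix whose number of columns varies with time; column e is
   read as 0 at the times at which it does not exist. *)
Definition measurable_mxdep (R : realType) (a : nat) (ne : R -> nat)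
    (D : forall t : R, 'M[R]_(a, ne t)) : Prop :=
  measurable_fun (`[0, +oo[ : set R) ne /\
  forall (i : 'I_a) (e : nat), measurable_fun (`[0, +oo[ : set R)
    (fun t => oapp (D t i) 0 (insub e : option 'I_(ne t))).

(* G is a simple undirected graph, the columns of D enumerate its edges, each
   of them once and with one of its two orientations. *)
Definition oriented_incidence (R : realType) (n m : nat) (G : rel 'I_n)
    (D : 'M[R]_(n, m)) : Prop :=
  [/\ symmetric G, irreflexive G &
    exists src snk : 'I_m -> 'I_n,
      [/\ forall e, G (src e) (snk e),
          forall i j, G i j -> exists! e : 'I_m,
            (src e = i /\ snk e = j) \/ (src e = j /\ snk e = i) &
          forall i e, D i e = (i == src e)%:R - (i == snk e)%:R]].

Definition laplacian (R : realType) (n m : nat) (D : 'M[R]_(n, m)) : 'M[R]_n :=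
  D *m D^T.

Definition Lambda (R : realType) (n N Ny m : nat) (alpha : R)
    (C : 'I_n -> 'M[R]_(Ny, N)) (D : 'M[R]_(n, m))
    : 'M[R]_(n * Ny + m * N, n * N) :=
  col_mx (blkdiag C) (Num.sqrt alpha *: (D^T *t (1%:M : 'M[R]_N))).

(* The eigenvalue 0 has algebraic multiplicity one, the others are >= lam. *)
Definition one_zero_eigenvalue_gap (R : realType) (n : nat) (A : 'M[R]_n)
    (lam : R) : Prop :=
  mup 0 (char_poly A) = 1%N /\
  forall a : R, eigenvalue A a -> a != 0 -> lam <= a.

Definition cond_i (R : realType) (n N Ny : nat)
    (C : 'I_n -> R -> 'M[R]_(Ny, N)) (T i1up i1lo : R) : Prop :=
  forall t : R, T <= t ->
    let G := mxint (t - T) t (fun s => \sum_i (C i s)^T *m C i s) in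
    lemx G i1up%:M /\ lemx i1lo%:M G.

Definition cond_ii (R : realType) (n N Ny : nat)
    (C : 'I_n -> R -> 'M[R]_(Ny, N)) (r2 : R) : Prop :=
  forall (t : R) (i : 'I_n), 0 <= t -> opnorm ((C i t)^T *m C i t) <= r2.

Definition cond_iii (R : realType) (n : nat) (ne : R -> nat)
    (D : forall t : R, 'M[R]_(n, ne t)) (T lam r3 : R) : Prop :=
  (forall t : R, T <= t -> one_zero_eigenvalue_gap
     (mxint (t - T) t (fun s => laplacian (D s))) lam) /\
  (forall t : R, 0 <= t -> opnorm (laplacian (D t)) <= r3).

Definition r4 (R : realType) (r2 r3 alpha : R) : R := r2 + alpha * r3.

Definition iota2_up (R : realType) (T r2 r3 alpha : R) : R :=
  T * r4 r2 r3 alpha.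

(* The minimum over the closed unit ball of R^N of a continuous function. *)
Definition iota2_lo (R : realType) (n N : nat) (T r2 i1lo lam alpha : R) : R :=
  inf [set Num.max (alpha * lam * (1 - enorm a ^+ 2))
             (i1lo / n%:R * enorm a ^+ 2
              - 2 * r2 * T * Num.sqrt (enorm a ^+ 2 * (1 - enorm a ^+ 2)))
      | a in [set a : 'cV[R]_N | enorm a ^+ 2 <= 1]].

Definition phi1 (R : realType) (r1 i2up : R) : R := r1 ^+ 2 * i2up ^+ 2 / 2.

Definition phi2 (R : realType) (r1 i2up : R) : R :=
  (expR (2 * r1 * i2up) - 1) / 4 - r1 * i2up / 2.

Definition iota3_up (R : realType) (n N : nat)
    (T r1 r2 r3 i1lo lam alpha : R) : R :=
  let i2up := iota2_up T r2 r3 alpha in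
  let i2lo := iota2_lo n N T r2 i1lo lam alpha in
  (Num.sqrt (i2up - i2lo + phi2 r1 i2up * i2lo) + Num.sqrt i2up) ^+ 2.

(* At phi1 = 1 the value is the limit of the general expression as phi1 tends
   to 1, so that iota3_lo is continuous in alpha. *)
Definition iota3_lo (R : realType) (n N : nat)
    (T r1 r2 r3 i1lo lam alpha : R) : R :=
  let i2up := iota2_up T r2 r3 alpha in
  let i2lo := iota2_lo n N T r2 i1lo lam alpha in
  let f1 := phi1 r1 i2up in
  if f1 == 1 then i2lo ^+ 2 / (4 * i2up)
  else ((Num.sqrt (i2up - i2lo + f1 * i2lo) - Num.sqrt i2up) / (f1 - 1)) ^+ 2.

Definition is_argmax_pos (R : realType) (f : R -> R) (a : R) : Prop :=
  0 < a /\ forall b : R, 0 < b -> f b <= f a.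

(* In the block matrices below q = n Ny + N n_e(t) and k = n N; D1 and D2 stand
   for the matrices with a bar. *)
Definition phi44 (R : realType) (q k r : nat) (c1 c2 g1 g i3up i3lo r4 : R)
    (D1 : 'M[R]_(k, r)) (D2 : 'M[R]_(q, r)) : 'M[R]_r :=
  (8 * c2 * i3up ^+ 2 / i3lo) *: (D1^T *m D1)
  + (c1 + 8 * c2 * i3up ^+ 2 * r4 * g1 / i3lo) *: (D2^T *m D2)
  - g%:M.

Definition Phi11_OE (R : realType) (q k p r : nat)
    (T c1 c2 g1 g i3up i3lo r4 : R)
    (D1 : 'M[R]_(k, r)) (D2 : 'M[R]_(q, r))
    (Q : 'M[R]_(p, q)) (W : 'M[R]_(p, r)) : 'M[R]_(q + (k + (p + r))) :=
  block_mx (- c1 + c2 * T)%:M             (row_mx 0 (row_mx Q^T 0))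
           (col_mx 0 (col_mx Q 0))
           (block_mx (- (c2 * i3lo / 2))%:M   0
                     0  (block_mx (- 1)%:M    W
                                  W^T         (phi44 c1 c2 g1 g i3up i3lo r4 D1 D2))).

Definition Phi12 (R : realType) (q k p r : nat) (c1 c2 i3lo : R)
    (D1 : 'M[R]_(k, r)) : 'M[R]_(q + (k + (p + r)), k) :=
  col_mx 0 (col_mx 0 (col_mx 0
    (- (2 * c1 / Num.sqrt (c2 * i3lo)) *: D1^T))).

Definition lmi (R : realType) (q k p r : nat)
    (T c1 c2 g1 g2 g i3up i3lo r4 : R)
    (D1 : 'M[R]_(k, r)) (D2 : 'M[R]_(q, r))
    (Q : 'M[R]_(p, q)) (W : 'M[R]_(p, r)) : Prop :=
  let B := Phi12 q p c1 c2 i3lo D1 in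
  lemx (block_mx (Phi11_OE T c1 c2 g1 g i3up i3lo r4 D1 D2 Q W) B
                 B^T (- g2)%:M) 0.

(* The feasible set of the semidefinite program, whose objective is g.  The
   matrices D2 and Q are constant except for their size, which is a function
   of the current number of edges; the matrix inequality has to hold for each
   size that occurs. *)
Definition sdp_feasible (R : realType) (n N Ny p r : nat) (ne : R -> nat)
    (T c2 i3up i3lo r4 : R) (D1 : 'M[R]_(n * N, r))
    (D2 : forall m : nat, 'M[R]_(n * Ny + m * N, r))
    (Q : forall m : nat, 'M[R]_(p, n * Ny + m * N)) (W : 'M[R]_(p, r))
    (c1 g1 g2 g : R) : Prop :=
  [/\ [/\ 0 < c1, 0 < g1 & 0 < g2], 0 < g, 0 <= g1 - g2 &
      forall t : R, 0 <= t ->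
        lmi T c1 c2 g1 g2 g i3up i3lo r4 D1 (D2 (ne t)) (Q (ne t)) W].

(* Solution in the sense of Caratheodory of x' = f(t, x), x(0) = x0, on
   [0, +oo[, i.e. in integrated form. *)
Definition ode_solution (R : realType) (k : nat)
    (f : R -> 'cV[R]_k -> 'cV[R]_k) (x0 : 'cV[R]_k) (x : R -> 'cV[R]_k)
    : Prop :=
  forall t : R, 0 <= t ->
    (forall i, (@lebesgue_measure R).-integrable `[0, t]
       (EFin \o (fun s => f s (x s) i 0))) /\
    x t = x0 + mxint 0 t (fun s => f s (x s)).

Definition energy (R : realType) (k : nat) (u : R -> 'cV[R]_k) : \bar R :=
  (\int[lebesgue_measure]_(s in `[0%R, +oo[) (((u s)^T *m u s) 0 0)%:E)%E.

Definition is_L2 (R : realType) (k : nat) (u : R -> 'cV[R]_k) : Prop :=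
  measurable_mx u /\ (energy u < +oo)%E.

Definition L2norm (R : realType) (k : nat) (u : R -> 'cV[R]_k) : R :=
  Num.sqrt (fine (energy u)).

(* +oo when H does not have a finite L2-gain. *)
Definition L2gain (R : realType) (r p : nat)
    (H : (R -> 'cV[R]_r) -> R -> 'cV[R]_p) : \bar R :=
  ereal_inf [set g%:E | g in [set g : R | 0 <= g /\
    exists b : R, 0 <= b /\ forall u, is_L2 u ->
      is_L2 (H u) /\ L2norm (H u) <= g * L2norm u + b]].

(* H is the input-output map of x' = f(t, x, u), y = h(t, x, u) with initial
   state x0. *)
Definition is_io_map (R : realType) (k r p : nat)
    (f : R -> 'cV[R]_k -> 'cV[R]_r -> 'cV[R]_k)
    (h : R -> 'cV[R]_k -> 'cV[R]_r -> 'cV[R]_p)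
    (x0 : 'cV[R]_k) (H : (R -> 'cV[R]_r) -> R -> 'cV[R]_p) : Prop :=
  forall u, is_L2 u -> exists x : R -> 'cV[R]_k,
    ode_solution (fun t xi => f t xi (u t)) x0 x /\
    forall t : R, 0 <= t -> H u t = h t (x t) (u t).

(* Main.v *)
Require Import Defs.
From mathcomp Require Import spectral sesquilinear complex measurable_realfun.
From mathcomp Require Import ring lra.
Set Implicit Arguments.
Unset Strict Implicit.
Unset Printing Implicit Defensive.

(** Write [xi = Lambda x], [e = xi - Delta2 delta] and [v = Delta1 delta], with
    the barred matrices. The error system is [x' = - Gamma Lambda^T e - v], so
    the storage function [V = c1 x^T Gamma^-1 x] satisfies

      V' = - 2 c1 xi . e - 2 c1 x . Gamma^-1 v
         = - c1 |xi|^2 - c1 |e|^2 + c1 |Delta2 delta|^2 - 2 c1 x . Gamma^-1 v.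

    Testing the matrix inequality on suitable vectors ([lmi_output],
    [lmi_input]) gives [|Q xi|^2 <= (c1 - c2 T) |xi|^2] and

      c1 |Delta2 delta|^2 + F |v|^2 + |delta|^2 <= gamma |delta|^2,
      F = 4 c1^2 / (c2 iota3_lo g2),

    while [|z|^2 = |Q xi|^2 + |delta|^2]. Hence it is enough to absorb the cross
    term [2 c1 x . Gamma^-1 v] into [c2 T |xi|^2 + c1 |e|^2 + F |v|^2]. This is
    impossible pointwise, since [xi] may vanish where [x] does not, but it can
    be done after integration over a window of length [T].

    On a window, [x] varies by an amount controlled by the integrals of [|e|]
    and [|v|], by the equation itself. Persistent excitation ([excitation])
    says that a constant state [y] satisfies
    [iota2_lo |y|^2 <= \int |Lambda y|^2]. Replacing the moving state by its value
    at one instant therefore bounds [|x|] on the whole window by the L2 norms of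
    [xi], [e] and [v] on that window ([x_bound]). The cross term is at most
    [2 c1 / sqrt g2] times this bound times the integral of [|v|], and
    [window_algebra] completes the squares; the inequality that makes the
    constants fit is [iota3_lo (1 + phi1) <= iota2_lo] ([iota3_lo_bounds]), which
    holds because [iota2_lo <= iota2_up].

    Summing over the windows from [j T] to [(j + 1) T] telescopes [V] and gives
    [\int |z|^2 <= V(0) + gamma \int |delta|^2], where [V(0)] depends only on
    the initial state. Fixed windows that tile the half line, instead of a window
    ending at the current time, are what avoids a separate treatment of the
    times before [T], where no window of past values is available.

    The excitation bound rests on the spectral theorem: the averaged Laplacian
    has a simple zero eigenvalue with eigenvector [1_n], so it is at least
    [lam] on the vectors of zero sum ([spectral_gap]). The product rule for [V]
    is needed for a state that is only a primitive of an integrable function; it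
    is obtained from the Fubini theorem ([segint_mul]). *)

(** * Euclidean and operator norms *)

Section Euclid.
Context {R : realType}.
Implicit Types m k : nat.

Definition dot m (x y : 'cV[R]_m) : R := (x^T *m y) 0 0.

Lemma dotE m (x y : 'cV[R]_m) : dot x y = \sum_i x i 0 * y i 0.
Proof. by rewrite /dot mxE; apply: eq_bigr => i _; rewrite mxE. Qed.

Lemma dotC m (x y : 'cV[R]_m) : dot x y = dot y x.
Proof. by rewrite !dotE; apply: eq_bigr => i _; rewrite mulrC. Qed.

Lemma dotDl m (x y z : 'cV[R]_m) : dot (x + y) z = dot x z + dot y z.
Proof. by rewrite /dot linearD mulmxDl mxE. Qed.

Lemma dotDr m (x y z : 'cV[R]_m) : dot z (x + y) = dot z x + dot z y.
Proof. by rewrite /dot mulmxDr mxE. Qed.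

Lemma dotNl m (x y : 'cV[R]_m) : dot (- x) y = - dot x y.
Proof. by rewrite /dot linearN mulNmx mxE. Qed.

Lemma dotNr m (x y : 'cV[R]_m) : dot x (- y) = - dot x y.
Proof. by rewrite dotC dotNl dotC. Qed.

Lemma dotZl m c (x y : 'cV[R]_m) : dot (c *: x) y = c * dot x y.
Proof. by rewrite /dot linearZ -scalemxAl mxE. Qed.

Lemma dotZr m c (x y : 'cV[R]_m) : dot x (c *: y) = c * dot x y.
Proof. by rewrite dotC dotZl dotC. Qed.

Lemma dot0l m (y : 'cV[R]_m) : dot 0 y = 0.
Proof. by rewrite /dot trmx0 mul0mx mxE. Qed.

Lemma dot0r m (y : 'cV[R]_m) : dot y 0 = 0.
Proof. by rewrite dotC dot0l. Qed.

Lemma dot_mulmx m k (A : 'M[R]_(m, k)) x y : dot (A *m x) y = dot x (A^T *m y).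
Proof. by rewrite /dot trmx_mul mulmxA. Qed.

Lemma dot_col_mx m k (u u' : 'cV[R]_m) (v v' : 'cV[R]_k) :
  dot (col_mx u v) (col_mx u' v') = dot u u' + dot v v'.
Proof. by rewrite /dot tr_col_mx mul_row_col mxE. Qed.

Lemma dot_suml m (J : finType) (F : J -> 'cV[R]_m) y :
  dot (\sum_i F i) y = \sum_i dot (F i) y.
Proof.
by elim/big_rec2: _ => [|i u v _ <-]; rewrite ?dot0l // dotDl.
Qed.

Lemma enorm_sq m (x : 'cV[R]_m) : enorm x ^+ 2 = dot x x.
Proof.
rewrite /enorm sqr_sqrtr ?dotE; first by apply: eq_bigr.
by apply: sumr_ge0 => i _; exact: sqr_ge0.
Qed.

Lemma enorm_ge0 m (x : 'cV[R]_m) : 0 <= enorm x.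
Proof. exact: sqrtr_ge0. Qed.

Lemma dot_ge0 m (x : 'cV[R]_m) : 0 <= dot x x.
Proof. by rewrite -enorm_sq exprn_ge0 // enorm_ge0. Qed.

Lemma enormE m (x : 'cV[R]_m) : enorm x = Num.sqrt (dot x x).
Proof. by rewrite -enorm_sq sqrtr_sqr ger0_norm // enorm_ge0. Qed.

Lemma enorm0 m : enorm (0 : 'cV[R]_m) = 0.
Proof. by rewrite enormE dot0l sqrtr0. Qed.

Lemma enorm_eq0 m (x : 'cV[R]_m) : (enorm x == 0) = (x == 0).
Proof.
apply/eqP/eqP => [h|->]; last exact: enorm0.
apply/matrixP => i j; rewrite ord1 mxE; apply/eqP; rewrite -sqrf_eq0.
have /eqP := enorm_sq x; rewrite h expr0n /= dotE eq_sym psumr_eq0.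
  by move=> /allP/(_ i (mem_index_enum i)); rewrite -expr2.
by move=> k _; rewrite -expr2 sqr_ge0.
Qed.

Lemma enormN m (x : 'cV[R]_m) : enorm (- x) = enorm x.
Proof. by rewrite !enormE dotNl dotNr opprK. Qed.

Lemma enormZ m c (x : 'cV[R]_m) : enorm (c *: x) = `|c| * enorm x.
Proof.
by rewrite !enormE dotZl dotZr mulrA -expr2 sqrtrM ?sqr_ge0 // sqrtr_sqr.
Qed.

(** The discriminant argument: the square of [enorm y *: x - enorm x *: y] is
    nonnegative. *)
Lemma dot_le_enorm m (x y : 'cV[R]_m) : dot x y <= enorm x * enorm y.
Proof.
have [x0|x0] := eqVneq x 0.
  by rewrite x0 dot0l mulr_ge0 // enorm_ge0.
have [y0|y0] := eqVneq y 0.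
  by rewrite y0 dotC dot0l mulr_ge0 // enorm_ge0.
have := dot_ge0 (enorm y *: x - enorm x *: y).
rewrite !(dotDl, dotDr, dotNl, dotNr, dotZl, dotZr) (dotC y x) -!enorm_sq.
have ex : 0 < enorm x by rewrite lt_neqAle eq_sym enorm_eq0 x0 enorm_ge0.
have ey : 0 < enorm y by rewrite lt_neqAle eq_sym enorm_eq0 y0 enorm_ge0.
move=> h; have exy := mulr_gt0 ex ey.
rewrite -(ler_pM2l exy).
nra.
Qed.

Lemma norm_dot_le m (x y : 'cV[R]_m) : `|dot x y| <= enorm x * enorm y.
Proof.
rewrite ler_norml dot_le_enorm andbT lerNl -dotNl -[enorm x]enormN.
exact: dot_le_enorm.
Qed.

Lemma enormD_sq m (x y : 'cV[R]_m) :
  enorm (x + y) ^+ 2 = enorm x ^+ 2 + 2 * dot x y + enorm y ^+ 2.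
Proof. rewrite !enorm_sq dotDl !dotDr (dotC y x); ring. Qed.

Lemma enormD m (x y : 'cV[R]_m) : enorm (x + y) <= enorm x + enorm y.
Proof.
rewrite -(@ler_pXn2r _ 2) // ?nnegrE ?addr_ge0 ?enorm_ge0 //.
rewrite enormD_sq; have := dot_le_enorm x y; nra.
Qed.

Lemma norm_coord_le m (x : 'cV[R]_m) i : `|x i 0| <= enorm x.
Proof.
rewrite -(@ler_pXn2r _ 2) // ?nnegrE ?enorm_ge0 // real_normK ?num_real //.
rewrite enorm_sq dotE (bigD1 i) //= -expr2 lerDl.
by apply: sumr_ge0 => k _; rewrite -expr2 sqr_ge0.
Qed.

(** The image of the unit ball is bounded (by the Frobenius norm), so that the
    supremum defining [opnorm] is one. *)
Lemma opnorm_ub m k (A : 'M[R]_(m, k)) :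
  has_ubound [set enorm (A *m y) | y in [set y : 'cV[R]_k | enorm y <= 1]].
Proof.
pose F := \sum_i enorm (row i A)^T ^+ 2.
have F0 : 0 <= F by apply: sumr_ge0 => i _; exact: sqr_ge0.
have bnd y : enorm (A *m y) ^+ 2 <= F * enorm y ^+ 2.
  rewrite enorm_sq dotE mulr_suml; apply: ler_sum => i _.
  have -> : (A *m y) i 0 = dot (row i A)^T y by rewrite /dot trmxK -row_mul [RHS]mxE.
  rewrite -expr2 -exprMn -(real_normK (num_real (dot _ _))).
  by apply: lerXn2r; rewrite ?nnegrE ?mulr_ge0 ?enorm_ge0 ?normr_ge0 ?norm_dot_le.
exists (Num.sqrt F) => _ [y /= y1 <-].
rewrite -(@ler_pXn2r _ 2) // ?nnegrE ?enorm_ge0 ?sqrtr_ge0 // (sqr_sqrtr F0).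
by apply: (le_trans (bnd y)); rewrite ler_piMr // expr_le1 ?enorm_ge0.
Qed.

Lemma opnorm_ge0 m k (A : 'M[R]_(m, k)) : 0 <= opnorm A.
Proof.
apply: (ub_le_sup (opnorm_ub A)); exists 0; rewrite /= ?mulmx0 enorm0 //.
Qed.

Lemma enorm_mulmx_le m k (A : 'M[R]_(m, k)) x :
  enorm (A *m x) <= opnorm A * enorm x.
Proof.
have [->|x0] := eqVneq x 0; first by rewrite mulmx0 !enorm0 mulr0.
have ex : 0 < enorm x by rewrite lt_neqAle eq_sym enorm_eq0 x0 enorm_ge0.
rewrite -ler_pdivrMr //; apply: (ub_le_sup (opnorm_ub A)).
exists ((enorm x)^-1 *: x) => /=.
  by rewrite enormZ ger0_norm ?invr_ge0 ?enorm_ge0 // mulVf // gt_eqF.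
by rewrite -scalemxAr enormZ ger0_norm ?invr_ge0 ?enorm_ge0 // mulrC.
Qed.

Lemma enorm_gram_le m k (A : 'M[R]_(m, k)) c x :
  opnorm (A^T *m A) <= c -> enorm (A *m x) ^+ 2 <= c * enorm x ^+ 2.
Proof.
move=> h; rewrite enorm_sq dot_mulmx mulmxA.
apply: le_trans (dot_le_enorm _ _) _.
rewrite expr2 mulrCA ler_wpM2l ?enorm_ge0 //.
apply: le_trans (enorm_mulmx_le _ _) _.
by rewrite ler_wpM2r ?enorm_ge0.
Qed.

(** [|A^T y|^2 = y . A A^T y <= |y| |A (A^T y)|], then divide by [|A^T y|]. *)
Lemma enorm_trmx_le m k (A : 'M[R]_(m, k)) c : 0 <= c ->
  (forall x, enorm (A *m x) ^+ 2 <= c * enorm x ^+ 2) ->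
  forall y, enorm (A^T *m y) ^+ 2 <= c * enorm y ^+ 2.
Proof.
move=> c0 h y; have [y0|y0] := eqVneq (A^T *m y) 0.
  by rewrite y0 enorm0 expr0n mulr_ge0 // sqr_ge0.
set z := A^T *m y.
have ez : 0 < enorm z by rewrite lt_neqAle eq_sym enorm_eq0 y0 enorm_ge0.
have h1 : enorm z ^+ 2 <= enorm y * enorm (A *m z).
  by rewrite enorm_sq {1}/z dot_mulmx trmxK; exact: dot_le_enorm.
have h2 := h z.
have h3 : (enorm z ^+ 2) ^+ 2 <= enorm y ^+ 2 * (c * enorm z ^+ 2).
  apply: (@le_trans _ _ ((enorm y * enorm (A *m z)) ^+ 2)).
    by apply: lerXn2r; rewrite ?nnegrE ?mulr_ge0 ?exprn_ge0 ?enorm_ge0.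
  by rewrite exprMn ler_wpM2l // sqr_ge0.
rewrite -(ler_pM2r (exprn_gt0 2 ez)) -expr2; apply: le_trans h3 _.
by rewrite mulrA [_ * c]mulrC.
Qed.

End Euclid.

(** * Spectral gap of a symmetric matrix *)

Section Spectral.
Context {R : realType}.
Local Open Scope sesquilinear_scope.
Local Notation f := (real_complex R).

(** The spectral theorem is available over a closed field, so a real symmetric
    matrix is diagonalized over [R[i]]. *)
Lemma conjC_real_complex (a : R) : (f a)^* = f a.
Proof. by apply/CrealP/complex_realP; exists a. Qed.

Lemma char_poly_conj (F : fieldType) n (P A : 'M[F]_n) : P \in unitmx ->
  char_poly (invmx P *m A *m P) = char_poly A.
Proof.
move=> Pu; rewrite /char_poly /char_poly_mx.
have -> : 'X%:M - map_mx polyC (invmx P *m A *m P) =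
   map_mx polyC (invmx P) *m ('X%:M - map_mx polyC A) *m map_mx polyC P.
  rewrite mulmxBr mulmxBl !map_mxM; congr (_ - _).
  by rewrite scalar_mxC -mulmxA -map_mxM mulVmx // map_mx1 mulmx1.
rewrite !det_mulmx mulrAC -det_mulmx -map_mxM mulVmx // map_mx1 det1 mul1r //.
Qed.

(** In an orthonormal basis of eigenvectors, the only vanishing eigenvalue
    belongs to the line of [1_n], because its algebraic multiplicity is one. A
    vector of zero sum has no component on that line. *)
Lemma spectral_gap n (A : 'M[R]_n) lam : (0 < n)%N ->
  A^T = A -> A *m const_mx 1 = 0 :> 'cV_n -> one_zero_eigenvalue_gap A lam ->
  forall y : 'cV[R]_n, \sum_i y i 0 = 0 -> lam * dot y y <= dot y (A *m y).
Proof.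
move=> n0 Asym A1 [mup1 gap] y sy.
pose AC := map_mx f A.
have ACt : AC ^t* = AC.
  apply/matrixP => i j; rewrite !mxE conjC_real_complex.
  by rewrite -[in LHS]Asym mxE.
have ACherm : AC \is hermsymmx.
  by apply/is_hermitianmxP; rewrite expr0 scale1r.
have /orthomx_spectralP := hermitian_normalmx ACherm.
have /mxOverP dreal := hermitian_spectral_diag_real ACherm.
have Pun := spectral_unitarymx AC; have Pu := spectral_unit AC.
set P := spectralmx AC in Pun Pu *; set d := spectral_diag AC in dreal *.
move=> ACE.
have chE : map_poly f (char_poly A) = \prod_(i < n) ('X - (d 0 i)%:P).
  rewrite map_char_poly -/AC ACE char_poly_conj // char_poly_trig.
    by apply: eq_bigr => i _; rewrite !mxE eqxx mulr1n.
  by apply/is_trig_mxP => i j ij; rewrite mxE -val_eqE /= ltn_eqF.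
have dR i : exists2 r : R, d 0 i = f r & eigenvalue A r.
  have /complex_realP[r dr] := dreal 0 i; exists r => //.
  rewrite eigenvalue_root_char -(fmorph_root f) chE rootE horner_prod.
  by apply/eqP; rewrite (bigD1 i) //= !hornerE dr subrr mul0r.
(* Two vanishing eigenvalues would make 'X^2 divide the characteristic
   polynomial, over R[i] hence over R. *)
have uniq0 i j : d 0 i = 0 -> d 0 j = 0 -> i = j.
  move=> di dj; apply/eqP; apply: contraT => ij.
  have : (2 <= mup 0 (char_poly A))%N.
    rewrite mup_geq ?monic_neq0 ?char_poly_monic // -(dvdp_map f) chE.
    rewrite rmorphXn rmorphB /= map_polyX map_polyC rmorph0 /=.
    rewrite (bigD1 i) //= (bigD1 j) 1?eq_sym //= di dj mulrA -expr2.
    exact: dvdp_mulIl.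
  by rewrite mup1.
pose yC := map_mx f y; pose w := P *m yC.
pose oC : 'cV[R[i]]_n := map_mx f (const_mx 1); pose u := P *m oC.
have PP : P ^t* *m P = 1%:M by rewrite -invmx_unitary // mulVmx.
have trC k (z : 'cV[R]_k) : (map_mx f z) ^t* = (map_mx f z)^T.
  by apply/matrixP => i j; rewrite !mxE conjC_real_complex.
have dotC2 (z z' : 'cV[R]_n) :
    f (dot z z') = \sum_i ((P *m map_mx f z) i 0)^* * (P *m map_mx f z') i 0.
  have -> : f (dot z z') = ((map_mx f z)^T *m map_mx f z') 0 0.
    rewrite /dot map_trmx -map_mxM. by rewrite [RHS]mxE.
  rewrite -(trC _ z) -[_ ^t*]mulmx1 -PP !mulmxA -map_mxM -trmx_mul -mulmxA.
  by rewrite mxE; apply: eq_bigr => i _; rewrite !mxE.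
have dw (z : 'cV[R]_n) i : (P *m map_mx f (A *m z)) i 0 = d 0 i * (P *m map_mx f z) i 0.
  have -> : P *m map_mx f (A *m z) = diag_mx d *m (P *m map_mx f z).
    by rewrite map_mxM -/AC ACE !mulmxA mulmxV // mul1mx.
  by rewrite mul_diag_mx mxE.
have du i : d 0 i = 0 \/ u i 0 = 0.
  have := dw (const_mx 1) i; rewrite A1 map_mx0 mulmx0 mxE.
  by move/esym/eqP; rewrite mulf_eq0 => /orP[] /eqP; [left | right].
have [i0 ui0] : exists i0, u i0 0 != 0.
  apply/existsP; apply: contraT; rewrite negb_exists => /forallP u0.
  have u00 : u = 0.
    by apply/colP => i; rewrite [RHS]mxE; apply/eqP; have := u0 i; rewrite negbK.
  move: u00 => /(congr1 (mulmx (invmx P))); rewrite mulKmx // mulmx0.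
  move/matrixP/(_ (Ordinal n0) 0); rewrite !mxE => /eqP.
  by rewrite rmorph1 oner_eq0.
have wi0 : w i0 0 = 0.
  have : f (dot (const_mx 1) y) = 0.
    rewrite dotE (eq_bigr (fun i => y i 0)) ?sy ?rmorph0 // => i _.
    by rewrite mxE mul1r.
  rewrite dotC2 (bigD1 i0) //= big1 ?addr0 => [/eqP|i ii0].
    by rewrite mulf_eq0 conjC_eq0 (negPf ui0) => /eqP.
  have [di|ui] := du i; last by rewrite ui rmorph0 mul0r.
  have [d0|/eqP] := du i0; last by rewrite (negPf ui0).
  by rewrite (uniq0 i i0) // eqxx in ii0.
rewrite -lecR rmorphM /= !dotC2 mulr_sumr; apply: ler_sum => i _.
rewrite dw -/w -/yC -/w [leRHS]mulrCA.
have [->|ii0] := eqVneq i i0; first by rewrite wi0 !mulr0.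
apply: ler_wpM2r; first by rewrite mulrC mul_conjC_ge0.
have [r dr er] := dR i; rewrite dr lecR; apply: gap => //.
apply: contra ii0 => /eqP r0.
have [d0|/eqP] := du i0; last by rewrite (negPf ui0).
by apply/eqP/uniq0; rewrite // dr r0 rmorph0.
Qed.

End Spectral.

(** * Integrals over segments *)

Section IntegralSegment.
Context {R : realType}.
Implicit Types (a b c : R) (f g h : R -> R).
Local Notation mu := (@lebesgue_measure R).

Definition integ a b f := mu.-integrable `[a, b] (EFin \o f).
Definition segint a b f : R := \int[mu]_(s in `[a, b]) f s.

Lemma integ_meas a b f : integ a b f -> measurable_fun `[a, b] f.
Proof. by move=> /integrableP[/measurable_EFinP]. Qed.

Lemma eq_segint a b f g : (forall s, a <= s <= b -> f s = g s) -> segint a b f = segint a b g.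
Proof.
by move=> fg; apply: eq_Rintegral => s; rewrite inE /= in_itv; exact: fg.
Qed.

Lemma eq_integ a b f g :
  (forall s, a <= s <= b -> f s = g s) -> integ a b f -> integ a b g.
Proof.
move=> fg; apply: eq_integrable => // s.
by rewrite inE /= in_itv /= => h; rewrite fg.
Qed.

Lemma le_integ a b f g : measurable_fun `[a, b] f ->
  (forall s, a <= s <= b -> `|f s| <= g s) -> integ a b g -> integ a b f.
Proof.
move=> mf fg; apply: le_integrable => //; first exact/measurable_EFinP.
move=> s; rewrite /= in_itv /= => h; rewrite lee_fin.
by rewrite (le_trans (fg _ h)) // ler_norm.
Qed.

Lemma integD a b f g : integ a b f -> integ a b g ->
  integ a b (fun s => f s + g s).
Proof. move=> hf hg; have : mu.-integrable `[a, b] ((EFin \o f) \+ (EFin \o g))%E.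
  exact: integrableD.
by apply: eq_integrable. Qed.

Lemma integZ a b f k : integ a b f -> integ a b (fun s => k * f s).
Proof. move=> hf; have : mu.-integrable `[a, b] (fun s => k%:E * (EFin \o f) s)%E.
  exact: integrableZl.
by apply: eq_integrable. Qed.

Lemma integN a b f : integ a b f -> integ a b (fun s => - f s).
Proof. move=> hf; have : mu.-integrable `[a, b] (-%E \o (EFin \o f))%E.
  exact: integrableN.
by apply: eq_integrable. Qed.

Lemma integB a b f g : integ a b f -> integ a b g ->
  integ a b (fun s => f s - g s).
Proof. by move=> hf hg; apply: integD => //; exact: integN. Qed.

Lemma integ_cst a b k : integ a b (fun _ => k).
Proof.
apply: measurable_bounded_integrable => //.
  by rewrite /= lebesgue_measure_itv /=; case: ifP => //; rewrite -EFinB ltry.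
by exists `|k|; split; [exact: num_real | move=> M kM s _ /=; exact: ltW].
Qed.

Lemma integ_sum a b (J : finType) (F : J -> R -> R) :
  (forall j, integ a b (F j)) -> integ a b (fun s => \sum_j F j s).
Proof.
move=> hF; have : mu.-integrable `[a, b] (fun s => \sum_j (EFin \o F j) s)%E.
  by apply: integrable_sum => // j _; exact: hF.
by apply: eq_integrable => // s _ /=; rewrite sumEFin.
Qed.

Lemma integS a b c d f : a <= c -> d <= b -> integ a b f -> integ c d f.
Proof.
move=> ac db; apply: integrableS => // s /=; rewrite !in_itv /=.
by case/andP => cs sd; rewrite (le_trans ac cs) (le_trans sd db).
Qed.

Lemma integM a b f h M : integ a b f -> measurable_fun `[a, b] h ->
  (forall s, a <= s <= b -> `|h s| <= M) -> integ a b (fun s => f s * h s).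
Proof.
move=> hf mh bh.
apply: (@le_integ _ _ _ (fun s => M * `|f s|)).
- by apply: measurable_funM => //; exact: integ_meas.
- by move=> s hs; rewrite normrM mulrC ler_wpM2r // bh.
- by apply: integZ; exact: integrable_norm.
Qed.

Lemma segintD a b f g : integ a b f -> integ a b g ->
  segint a b (fun s => f s + g s) = segint a b f + segint a b g.
Proof. by move=> hf hg; exact: RintegralD. Qed.

Lemma segintB a b f g : integ a b f -> integ a b g ->
  segint a b (fun s => f s - g s) = segint a b f - segint a b g.
Proof. by move=> hf hg; exact: RintegralB. Qed.

Lemma segintZ a b f k : integ a b f -> segint a b (fun s => k * f s) = k * segint a b f.
Proof. by move=> hf; exact: RintegralZl. Qed.

Lemma segint_cst a b k : a <= b -> segint a b (fun _ => k) = k * (b - a).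
Proof.
move=> ab; rewrite /segint Rintegral_cst //= lebesgue_measure_itv /= lte_fin.
case: ltP => [|ba] //=; have -> : a = b by apply/eqP; rewrite eq_le ab.
by rewrite subrr.
Qed.

Lemma segint_sum a b (J : finType) (F : J -> R -> R) :
  (forall j, integ a b (F j)) -> segint a b (fun s => \sum_j F j s) = \sum_j segint a b (F j).
Proof.
move=> hF; rewrite /segint /Rintegral.
under eq_integral do rewrite -sumEFin.
rewrite integral_sum //; rewrite -sum_fine // => j _.
  by apply: (integrable_fin_num _ (hF j)).
Qed.

Lemma le_segint a b f g : integ a b f -> integ a b g ->
  (forall s, a <= s <= b -> f s <= g s) -> segint a b f <= segint a b g.
Proof.
by move=> hf hg fg; exact: le_Rintegral.
Qed.

Lemma segint_ge0 a b f : (forall s, a <= s <= b -> 0 <= f s) -> 0 <= segint a b f.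
Proof.
by move=> f0; apply: Rintegral_ge0 => s; rewrite /= in_itv; exact: f0.
Qed.

Lemma segint_split a b c f : integ a b f -> a <= c -> c <= b ->
  segint a b f = segint a c f + segint c b f.
Proof.
move=> hf ac cb; rewrite /segint; apply/eqP; rewrite addrC -subr_eq; apply/eqP.
rewrite Rintegral_itvB // ?bnd_simp //.
by rewrite Rintegral_itv_obnd_cbnd //; apply: integrableS hf => // s /=;
   rewrite !in_itv /= => /andP[/ltW cs ->]; rewrite (le_trans ac cs).
Qed.

Lemma segint_point a f : segint a a f = 0.
Proof. by rewrite /segint set_itv1 Rintegral_set1. Qed.

(** The Cauchy-Schwarz inequality against the constant 1: the variance of [f]
    on the segment is nonnegative. *)
Lemma segint_sqr_le a b f : a <= b -> integ a b f ->
  integ a b (fun s => f s ^+ 2) ->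
  segint a b f ^+ 2 <= (b - a) * segint a b (fun s => f s ^+ 2).
Proof.
move=> ab hf hf2.
have [ba|ba] := eqVneq a b.
  by rewrite ba segint_point expr0n subrr mul0r.
have l0 : 0 < b - a by rewrite subr_gt0 lt_neqAle ba.
pose m := segint a b f / (b - a).
have : 0 <= segint a b (fun s => f s ^+ 2 + ((- (2 * m)) * f s + m ^+ 2)).
  apply: segint_ge0 => s _; have -> : f s ^+ 2 + (- (2 * m) * f s + m ^+ 2) = (f s - m) ^+ 2.
    by ring.
  exact: sqr_ge0.
have i1 := integZ (- (2 * m)) hf; have i2 := integ_cst a b (m ^+ 2).
rewrite segintD //; last exact: integD.
rewrite segintD // segintZ // segint_cst //.
have -> : segint a b f = m * (b - a) by rewrite /m divfK // gt_eqF.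
nra.
Qed.

Lemma integ_of_sqr a b f : measurable_fun `[a, b] f ->
  integ a b (fun s => f s ^+ 2) -> integ a b f.
Proof.
move=> mf hf2; apply: (@le_integ _ _ _ (fun s => 1 + f s ^+ 2)) => //.
  move=> s _; rewrite -[f s ^+ 2]real_normK ?num_real //.
  by have := sqr_ge0 (`|f s| - 1); nra.
exact: integD (integ_cst a b 1) hf2.
Qed.

Lemma segint_continuous a b f : a <= b -> integ a b f ->
  {within `[a, b], continuous (fun t => segint a t f)}.
Proof. by move=> ab hf; exact: parameterized_integral_continuous. Qed.

Lemma norm_segint_le a b f t : integ a b f -> a <= t <= b ->
  `|segint a t f| <= segint a b (fun s => `|f s|).
Proof.
move=> hf /andP[at_ tb].
have hn : integ a b (fun s => `|f s|) by exact: integrable_norm.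
apply: (@le_trans _ _ (segint a t (fun s => `|f s|))).
  by apply: le_normr_Rintegral => //; exact: integS hf.
by rewrite (segint_split hn at_ tb) lerDl; apply: segint_ge0.
Qed.

Lemma integ_setT a b f : integ a b f ->
  mu.-integrable [set: R] ((EFin \o f) \_ [set` `[a, b]]).
Proof.
move=> hf.
have [h _] := @integrable_mkcond _ _ R mu [set` `[a, b]] (EFin \o f) (measurable_itv _).
exact: h.
Qed.

(** Both sides are the integral of [f s * g t] over the triangle
    [a <= s <= t <= b]. *)
Lemma segint_triangle a b f g : a <= b -> integ a b f -> integ a b g ->
  segint a b (fun t => g t * segint a t f) = segint a b (fun s => f s * segint s b g).
Proof.
move=> ab hf hg; pose D : set R := [set` `[a, b]].
pose ff := f \_ D; pose gg := g \_ D.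
have iff : mu.-integrable setT (EFin \o ff).
  by rewrite -restrict_EFin; exact: integ_setT.
have igg : mu.-integrable setT (EFin \o gg).
  by rewrite -restrict_EFin; exact: integ_setT.
have mff : measurable_fun setT ff by apply/measurable_EFinP; case/integrableP: iff.
have mgg : measurable_fun setT gg by apply/measurable_EFinP; case/integrableP: igg.
pose k (z : R * R) : R := ff z.1 * gg z.2 * (z.1 <= z.2)%R%:R.
pose K (z : R * R) : R := ff z.1 * gg z.2.
have mK : measurable_fun setT K.
  apply: measurable_funM.
    exact: (measurableT_comp mff).
  exact: (measurableT_comp mgg).
have mk : measurable_fun setT k.
  apply: measurable_funM => //.
  have -> : (fun z : R * R => (z.1 <= z.2)%R%:R : R) =
    (fun z => if (z.1 <= z.2)%R then 1 else 0 : R).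
    by apply/funext => z; case: ifP.
  apply: measurable_fun_ifT => //.
  by apply: measurable_fun_ler.
have iK : (mu \x mu)%E.-integrable setT (EFin \o K).
  apply/integrable12ltyP; first exact/measurable_EFinP.
  under eq_integral => x _.
    under eq_integral => y _ do rewrite /K /= normrM EFinM.
    rewrite ge0_integralZl //; last 1 first.
      by apply/measurable_EFinP/measurableT_comp.
    over.
  rewrite /= ge0_integralZr //.
  - by apply: lte_mul_pinfty;
     [exact: integral_ge0
     |by apply: integrable_fin_num => //; exact: integrable_norm
     |by case/integrableP: igg].
  - by apply/measurable_EFinP/measurableT_comp.
  - exact: integral_ge0.
have ik : (mu \x mu)%E.-integrable setT (EFin \o k).
  apply: le_integrable iK => //; first exact/measurable_EFinP.
  move=> z _ /=; rewrite lee_fin /k normrM ler_piMr //.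
  by case: (z.1 <= z.2)%R; rewrite ?normr1 ?normr0.
have /(congr1 fine) fub := Fubini ik.
have E1 x : (\int[mu]_y (EFin \o k) (x, y) =
   (((fun s => f s * segint s b g) \_ D) x)%:E)%E.
  rewrite /= /k /= /ff !patchE; case: ifPn => [|_]; last first.
    by rewrite (eq_integral (cst 0)%E) ?integral0 // => y _; rewrite !mul0r.
  rewrite inE /D /= in_itv /= => /andP[ax xb].
  transitivity (\int[mu]_y ((f x)%:E * ((EFin \o g) \_ [set` `[x, b]]) y))%E.
    apply: eq_integral => y _; rewrite /gg restrict_EFin /= !patchE -EFinM -mulrA; congr (_ * _)%:E.
    rewrite !mem_setE /D !in_itv /=.
    case: (leP x y) => xy; last by rewrite mulr0.
    by rewrite (le_trans ax xy) mulr1.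
  have ix : integ x b g by exact: integS hg.
  rewrite integralZl //; last exact: integ_setT.
  rewrite -integral_mkcond EFinM /segint /Rintegral fineK //.
  exact: integrable_fin_num.
have E2 y : (\int[mu]_x (EFin \o k) (x, y) =
   (((fun t => g t * segint a t f) \_ D) y)%:E)%E.
  rewrite /= /k /= /gg !patchE; case: ifPn => [|_]; last first.
    by rewrite (eq_integral (cst 0)%E) ?integral0 // => x _; rewrite mulr0 !mul0r.
  rewrite inE /D /= in_itv /= => /andP[ay yb].
  transitivity (\int[mu]_x ((g y)%:E * ((EFin \o f) \_ [set` `[a, y]]) x))%E.
    apply: eq_integral => x _; rewrite /ff restrict_EFin /= !patchE -EFinM mulrAC mulrC.
    congr (_ * _)%:E.
    rewrite !mem_setE /D !in_itv /=.
    case: (leP x y) => xy; last by rewrite mulr0 andbF.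
    by rewrite (le_trans xy yb) mulr1.
  have ix : integ a y f by exact: integS hf.
  rewrite integralZl //; last exact: integ_setT.
  rewrite -integral_mkcond EFinM /segint /Rintegral fineK //.
  exact: integrable_fin_num.
have -> : segint a b (fun s => f s * segint s b g) =
    fine (\int[mu]_x \int[mu]_y (EFin \o k) (x, y))%E.
  rewrite {1}/segint Rintegral_mkcond; congr fine; apply: eq_integral => x _.
  exact/esym/E1.
rewrite fub {1}/segint Rintegral_mkcond; congr fine; apply: eq_integral => y _.
exact/esym/E2.
Qed.

(** The product rule for absolutely continuous functions, in integrated form.
    [F] and [G] need not be differentiable everywhere, so the proof does not
    differentiate: it exchanges integrals, and the two triangles
    [s <= t] and [t <= s] make up the square [(\int f) (\int g)]. *)
Lemma segint_mul a b f g F G : a <= b -> integ a b f -> integ a b g ->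
  (forall t, a <= t <= b -> F t = F a + segint a t f) ->
  (forall t, a <= t <= b -> G t = G a + segint a t g) ->
  integ a b (fun t => f t * G t) /\ integ a b (fun t => g t * F t) /\
  F b * G b - F a * G a = segint a b (fun t => f t * G t) + segint a b (fun t => g t * F t).
Proof.
move=> ab hf hg hF hG.
have hI (p q : R -> R) : integ a b p -> integ a b q ->
    integ a b (fun t => p t * segint a t q).
  move=> hp hq; apply: (@integM _ _ _ _ (segint a b (fun s => `|q s|))) => //.
    apply: subspace_continuous_measurable_fun => //; exact: segint_continuous.
  by move=> s; exact: norm_segint_le.
have hfG : integ a b (fun t => f t * G t).
  apply: (@eq_integ _ _ (fun t => G a * f t + f t * segint a t g)).
    by move=> s hs; rewrite (hG _ hs); ring.
  by apply: integD; [exact: integZ | exact: hI].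
have hgF : integ a b (fun t => g t * F t).
  apply: (@eq_integ _ _ (fun t => F a * g t + g t * segint a t f)).
    by move=> s hs; rewrite (hF _ hs); ring.
  by apply: integD; [exact: integZ | exact: hI].
split=> //; split=> //.
have -> : segint a b (fun t => g t * F t) =
    F a * segint a b g + segint a b (fun t => g t * segint a t f).
  rewrite -segintZ // -segintD; [|exact: integZ|exact: hI].
  by apply: eq_segint => s hs; rewrite (hF _ hs); ring.
rewrite segint_triangle //.
have hfI : integ a b (fun s => f s * segint s b g).
  apply: (@eq_integ _ _ (fun t => segint a b g * f t - f t * segint a t g)).
    by move=> s /andP[as_ sb]; rewrite (segint_split hg as_ sb); ring.
  by apply: integB; [exact: integZ | exact: hI].
have E : segint a b (fun t => f t * G t) + segint a b (fun s => f s * segint s b g) =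
    (G a + segint a b g) * segint a b f.
  rewrite -(segintD hfG hfI) -(segintZ _ hf); apply: eq_segint => s hs; rewrite (hG _ hs).
  by case/andP: hs => as_ sb; rewrite (segint_split hg as_ sb); ring.
have abb : a <= b <= b by rewrite ab lexx.
by rewrite addrCA E (hF _ abb) (hG _ abb); ring.
Qed.

End IntegralSegment.

(** * Agents, coordinates and the norm of Lambda *)

Section Blocks.
Context {R : realType}.
Variables (n N : nat).
Implicit Types x : 'cV[R]_(n * N).

(** A stacked state, read by agents (the argument of the regressors) or by
    coordinates (the argument of the Laplacian). *)
Definition agent x (i : 'I_n) : 'cV[R]_N := \col_c x (mxtens_index (i, c)) 0.
Definition coord x (c : 'I_N) : 'cV[R]_n := \col_i x (mxtens_index (i, c)) 0.

Lemma sum_mxtens m k (F : 'I_(m * k) -> R) :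
  \sum_j F j = \sum_(i < m) \sum_(c < k) F (mxtens_index (i, c)).
Proof.
rewrite pair_big (reindex (@mxtens_index m k)) /=.
  by apply: eq_bigr => -[i c] _.
by exists (@mxtens_unindex m k) => i _; rewrite (mxtens_indexK, mxtens_unindexK).
Qed.

Lemma enorm_agent x : enorm x ^+ 2 = \sum_i enorm (agent x i) ^+ 2.
Proof.
rewrite enorm_sq dotE sum_mxtens; apply: eq_bigr => i _.
by rewrite enorm_sq dotE; apply: eq_bigr => c _; rewrite mxE.
Qed.

Lemma enorm_coord x : enorm x ^+ 2 = \sum_c enorm (coord x c) ^+ 2.
Proof.
rewrite enorm_sq dotE sum_mxtens exchange_big; apply: eq_bigr => c _.
by rewrite enorm_sq dotE; apply: eq_bigr => i _; rewrite mxE.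
Qed.

Lemma enorm_blkdiag Ny (C : 'I_n -> 'M[R]_(Ny, N)) x :
  enorm (blkdiag C *m x) ^+ 2 = \sum_i enorm (C i *m agent x i) ^+ 2.
Proof.
rewrite enorm_sq dotE sum_mxtens; apply: eq_bigr => i _.
rewrite enorm_sq dotE; apply: eq_bigr => y _.
suff -> : (blkdiag C *m x) (mxtens_index (i, y)) 0 = (C i *m agent x i) y 0 by [].
rewrite !mxE sum_mxtens (bigD1 i) //= [X in _ + X]big1 ?addr0.
  apply: eq_bigr => c _; rewrite mxE; congr (_ * _).
  rewrite /blkdiag summxE (bigD1 i) //= tensmxE mxE !eqxx mul1r.
  rewrite big1 ?addr0 // => j ji.
  by rewrite tensmxE mxE eq_sym (negPf ji) mul0r.
move=> k ki; rewrite big1 // => c _.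
rewrite /blkdiag summxE big1 ?mul0r // => j _.
rewrite tensmxE mxE; case: eqP => [<-|]; rewrite ?mul0r //=.
by rewrite (negPf ki) mul0r.
Qed.

Lemma enorm_tens1 m (D : 'M[R]_(n, m)) x :
  enorm ((D^T *t (1%:M : 'M[R]_N)) *m x) ^+ 2 =
  \sum_c enorm (D^T *m coord x c) ^+ 2.
Proof.
rewrite enorm_sq dotE sum_mxtens exchange_big; apply: eq_bigr => c _.
rewrite enorm_sq dotE; apply: eq_bigr => e _.
suff -> : ((D^T *t (1%:M : 'M[R]_N)) *m x) (mxtens_index (e, c)) 0 =
  (D^T *m coord x c) e 0 by [].
rewrite !mxE sum_mxtens; apply: eq_bigr => i _.
rewrite (bigD1 c) //= tensmxE !mxE eqxx mulr1 big1 ?addr0 // => d dc.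
by rewrite tensmxE !mxE eq_sym (negPf dc) mulr0 mul0r.
Qed.

Lemma enorm_col_mx p q (u : 'cV[R]_p) (v : 'cV[R]_q) :
  enorm (col_mx u v) ^+ 2 = enorm u ^+ 2 + enorm v ^+ 2.
Proof. by rewrite !enorm_sq dot_col_mx. Qed.

Lemma enorm_Lambda Ny m (C : 'I_n -> 'M[R]_(Ny, N)) (D : 'M[R]_(n, m)) alpha x :
  0 <= alpha ->
  enorm (Lambda alpha C D *m x) ^+ 2 =
  \sum_i enorm (C i *m agent x i) ^+ 2
  + alpha * \sum_c enorm (D^T *m coord x c) ^+ 2.
Proof.
move=> a0; rewrite /Lambda mul_col_mx enorm_col_mx enorm_blkdiag -scalemxAl.
by rewrite enormZ exprMn enorm_tens1 real_normK ?num_real // sqr_sqrtr.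
Qed.

Lemma enorm_Lambda_le Ny m (C : 'I_n -> 'M[R]_(Ny, N)) (D : 'M[R]_(n, m))
    alpha r2 r3 x : 0 <= alpha ->
  (forall i, opnorm ((C i)^T *m C i) <= r2) -> opnorm (laplacian D) <= r3 ->
  enorm (Lambda alpha C D *m x) ^+ 2 <= r4 r2 r3 alpha * enorm x ^+ 2.
Proof.
move=> a0 hC hD; rewrite enorm_Lambda // /r4 mulrDl -mulrA.
apply: lerD.
  rewrite enorm_agent mulr_sumr; apply: ler_sum => i _.
  exact: enorm_gram_le.
rewrite ler_wpM2l // enorm_coord mulr_sumr; apply: ler_sum => c _.
by apply: enorm_gram_le; rewrite trmxK.
Qed.

End Blocks.

Lemma opnorm_entry (R : realType) m k (A : 'M[R]_(m, k)) i j :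
  `|A i j| <= opnorm A.
Proof.
have -> : A i j = (A *m (delta_mx j 0 : 'cV_k)) i 0 by rewrite -colE mxE.
apply: le_trans (norm_coord_le _ _) _; apply: le_trans (enorm_mulmx_le _ _) _.
suff -> : enorm (delta_mx j 0 : 'cV[R]_k) = 1 by rewrite mulr1.
rewrite enormE dotE (bigD1 j) //= mxE !eqxx mulr1 big1 ?addr0 ?sqrtr1 // => l lj.
by rewrite mxE (negPf lj) mul0r.
Qed.

(** * Persistent excitation *)

Section MxInt.
Context {R : realType}.

Lemma dot_mulmxE m k (A : 'M[R]_(m, k)) y z :
  dot y (A *m z) = \sum_i \sum_j (y i 0 * z j 0) * A i j.
Proof.
rewrite dotE; apply: eq_bigr => i _; rewrite mxE mulr_sumr.
by apply: eq_bigr => j _; ring.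
Qed.

Variables (a b : R).

Lemma integ_dot m k (A : R -> 'M[R]_(m, k)) y z :
  (forall i j, integ a b (fun s => A s i j)) ->
  integ a b (fun s => dot y (A s *m z)).
Proof.
move=> hA; apply: (@eq_integ _ _ _ (fun s => \sum_i \sum_j (y i 0 * z j 0) * A s i j)).
  by move=> s _; rewrite dot_mulmxE.
by apply: integ_sum => i; apply: integ_sum => j; exact: integZ.
Qed.

Lemma dot_mxint m k (A : R -> 'M[R]_(m, k)) y z :
  (forall i j, integ a b (fun s => A s i j)) ->
  segint a b (fun s => dot y (A s *m z)) = dot y (mxint a b A *m z).
Proof.
move=> hA; rewrite dot_mulmxE.
rewrite (@eq_segint _ _ _ _ (fun s => \sum_i \sum_j (y i 0 * z j 0) * A s i j)); last first.
  by move=> s _; rewrite dot_mulmxE.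
rewrite segint_sum => [|i]; last by apply: integ_sum => j; exact: integZ.
apply: eq_bigr => i _; rewrite segint_sum => [|j]; last exact: integZ.
by apply: eq_bigr => j _; rewrite segintZ // mxE.
Qed.

End MxInt.

Section Graph.
Context {R : realType}.

(** Every column has one entry 1 and one entry -1. *)
Lemma incidence_ones n m (G : rel 'I_n) (D : 'M[R]_(n, m)) :
  oriented_incidence G D -> D^T *m const_mx 1 = 0 :> 'cV_m.
Proof.
move=> [_ _ [src [snk [_ _ DE]]]]; apply/colP => e; rewrite !mxE.
rewrite (eq_bigr (fun i => (i == src e)%:R - (i == snk e)%:R)); last first.
  by move=> i _; rewrite !mxE mulr1 DE.
have one j : \sum_(i < n) (i == j)%:R = 1 :> R.
  by rewrite (bigD1 j) //= eqxx big1 ?addr0 // => i /negPf ->.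
by rewrite sumrB !one subrr.
Qed.

Lemma laplacian_sym n m (D : 'M[R]_(n, m)) : (laplacian D)^T = laplacian D.
Proof. by rewrite /laplacian trmx_mul trmxK. Qed.

Lemma sum_le_sqrt n (F : 'I_n -> R) :
  \sum_i F i <= Num.sqrt n%:R * Num.sqrt (\sum_i F i ^+ 2).
Proof.
have := dot_le_enorm (const_mx 1 : 'cV[R]_n) (\col_i F i).
have -> : dot (const_mx 1) (\col_i F i) = \sum_i F i.
  by rewrite dotE; apply: eq_bigr => i _; rewrite !mxE mul1r.
have -> : enorm (const_mx 1 : 'cV[R]_n) = Num.sqrt n%:R.
  congr Num.sqrt; rewrite (eq_bigr (fun=> 1)) ?sumr_const ?card_ord // => i _.
  by rewrite mxE expr1n.
have -> // : enorm (\col_i F i) = Num.sqrt (\sum_i F i ^+ 2).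
by congr Num.sqrt; apply: eq_bigr => i _; rewrite mxE.
Qed.

End Graph.

Section Excitation.
Context {R : realType}.
Variables (n N : nat) (n_gt0 : (0 < n)%N).
Variables (T r2 i1lo lam alpha : R).
Hypotheses (T_gt0 : 0 < T) (i1lo_gt0 : 0 < i1lo) (r2_gt0 : 0 < r2).
Hypotheses (lam_gt0 : 0 < lam) (alpha_gt0 : 0 < alpha).

Local Notation i2lo := (iota2_lo n N T r2 i1lo lam alpha).
Local Notation val s := (Num.max (alpha * lam * (1 - s))
   (i1lo / n%:R * s - 2 * r2 * T * Num.sqrt (s * (1 - s)))).

Let nR : 0 < n%:R :> R. Proof. by rewrite ltr0n. Qed.

Lemma iota2_lo_le (v : 'cV[R]_N) : enorm v ^+ 2 <= 1 ->
  i2lo <= val (enorm v ^+ 2).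
Proof.
move=> v1; apply: ge_inf; last by exists v.
exists 0 => _ [w /= w1 <-]; rewrite le_max; apply/orP; left.
by rewrite mulr_ge0 ?subr_ge0 // mulr_ge0 // ltW.
Qed.

(** With [s] the squared norm of the argument, the first member of the maximum
    is bounded below where [s] is away from 1, the second one where [s] is close
    to 1. *)
Lemma iota2_lo_gt0 : 0 < i2lo.
Proof.
pose k := i1lo / n%:R; have k0 : 0 < k by rewrite divr_gt0.
pose q := 2 * r2 * T; have q0 : 0 < q by rewrite !mulr_gt0.
(* For 1 - s < e^2 the square root is below e, so the subtracted term is at
   most k / 4, while k s is at least 3 k / 4. *)
pose e := Num.min (1 / 2) (k / (4 * q)).
have e0 : 0 < e by rewrite lt_min !divr_gt0 // mulr_gt0.
have e1 : e <= 1 / 2 by rewrite ge_min lexx.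
have e2 : q * e <= k / 4.
  have : e <= k / (4 * q) by rewrite ge_min lexx orbT.
  rewrite ler_pdivlMr ?mulr_gt0 // => h; lra.
pose m := Num.min (alpha * lam * e ^+ 2) (k / 2).
have m0 : 0 < m.
  by rewrite lt_min; apply/andP; split; rewrite ?divr_gt0 ?mulr_gt0 ?exprn_gt0.
apply: (lt_le_trans m0); apply: lb_le_inf.
  by exists (val (enorm (0 : 'cV[R]_N) ^+ 2)); exists 0 => //=; rewrite enorm0 expr0n.
move=> _ [v /= v1 <-].
move: (enorm v ^+ 2) v1 (sqr_ge0 (enorm v)) => s v1 s0.
rewrite le_max; have [h|h] := leP (e ^+ 2) (1 - s).
  apply/orP; left; rewrite ge_min; apply/orP; left.
  by rewrite ler_wpM2l // mulr_ge0 // ltW.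
apply/orP; right; rewrite ge_min; apply/orP; right.
have hs : Num.sqrt (s * (1 - s)) <= e.
  rewrite -(@ler_pXn2r _ 2) // ?nnegrE ?sqrtr_ge0 ?(ltW e0) //.
  rewrite sqr_sqrtr ?mulr_ge0 ?subr_ge0 //.
  by apply: (@le_trans _ _ (1 - s)); [rewrite ler_piMl ?subr_ge0|exact: ltW].
rewrite -/k -/q.
have : q * Num.sqrt (s * (1 - s)) <= q * e by apply: ler_wpM2l => //; exact: ltW.
have e4 : e ^+ 2 <= 1 / 4 by nra.
have : 3 / 4 <= s by lra.
nra.
Qed.

Variables (Ny : nat) (C : 'I_n -> R -> 'M[R]_(Ny, N)).
Variables (ne : R -> nat) (D : forall t, 'M[R]_(n, ne t)) (G : R -> rel 'I_n).
Variable (w : R).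
Local Notation w' := (w + T).
Let gram s := \sum_i (C i s)^T *m C i s.
Hypothesis C_le : forall s i, w <= s <= w' -> opnorm ((C i s)^T *m C i s) <= r2.
Hypothesis D_inc : forall s, w <= s <= w' -> oriented_incidence (G s) (D s).
Hypothesis gram_integ : forall k i j, integ w w' (fun s => ((C k s)^T *m C k s) i j).
Hypothesis lap_integ : forall i j, integ w w' (fun s => laplacian (D s) i j).
Hypothesis gram_lo : lemx i1lo%:M (mxint w w' gram).
Hypothesis lap_gap : one_zero_eigenvalue_gap (mxint w w' (fun s => laplacian (D s))) lam.

Let M := mxint w w' (fun s => laplacian (D s)).

Let ww : w <= w'. Proof. by rewrite lerDl ltW. Qed.

Let M_sym : M^T = M.
Proof.
apply/matrixP => i j; rewrite !mxE; apply: eq_Rintegral => s _ /=.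
by rewrite -[in LHS]laplacian_sym mxE.
Qed.

Let M_ones : M *m const_mx 1 = 0 :> 'cV_n.
Proof.
apply/eqP; rewrite -enorm_eq0 -sqrf_eq0 enorm_sq -(dot_mxint _ _ lap_integ).
rewrite (@eq_segint _ _ _ _ (fun=> 0)) ?segint_cst ?mul0r // => s hs.
by rewrite /laplacian -mulmxA (incidence_ones (D_inc hs)) mulmx0 dotC dot0l.
Qed.

(** The subtracted term is the squared norm of the projection of [y] onto the
    line of [1_n], which lies in the kernel of the averaged Laplacian. *)
Lemma laplacian_window (y : 'cV[R]_n) :
  lam * (dot y y - n%:R * ((\sum_i y i 0) / n%:R) ^+ 2) <=
  segint w w' (fun s => dot y (laplacian (D s) *m y)).
Proof.
set m := _ / _; rewrite dot_mxint // -/M.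
have sy : \sum_i y i 0 = n%:R * m by rewrite mulrC divfK // gt_eqF.
have [z yE] : exists z, y = z + m *: const_mx 1.
  by exists (y - m *: const_mx 1); rewrite subrK.
have sz : \sum_i z i 0 = 0.
  rewrite (eq_bigr (fun i => y i 0 - m)) => [|i _]; last first.
    by rewrite yE !mxE mulr1 addrK.
  by rewrite sumrB sy sumr_const card_ord mulr_natl subrr.
have d1 (u : 'cV[R]_n) : dot u (const_mx 1) = \sum_i u i 0.
  by rewrite dotE; apply: eq_bigr => i _; rewrite mxE mulr1.
have := spectral_gap n_gt0 M_sym M_ones lap_gap sz.
have -> : dot y (M *m y) = dot z (M *m z).
  have My : M *m y = M *m z by rewrite yE mulmxDr -scalemxAr M_ones scaler0 addr0.
  by rewrite My -[in LHS]M_sym -dot_mulmx My dot_mulmx M_sym.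
suff -> : dot z z = dot y y - n%:R * m ^+ 2 by [].
rewrite {1 2}yE !(dotDl, dotDr, dotZl, dotZr) (dotC (const_mx 1)) !d1 sz.
rewrite (eq_bigr (fun=> 1)) ?sumr_const ?card_ord => [|i _]; last by rewrite mxE.
ring.
Qed.

Lemma gram_window (m : 'cV[R]_N) :
  i1lo * enorm m ^+ 2 <= segint w w' (fun s => \sum_i enorm (C i s *m m) ^+ 2).
Proof.
have [_ /(_ m)] := gram_lo; rewrite -mulmxA -/(dot _ _) mulmxBl dotDr dotNr.
rewrite mul_scalar_mx dotZr -enorm_sq subr_ge0 => /le_trans; apply.
rewrite -dot_mxint => [|i j].
  rewrite le_eqVlt; apply/orP; left; apply/eqP; apply: eq_segint => s _.
  rewrite /gram mulmx_suml dotC dot_suml; apply: eq_bigr => i _.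
  by rewrite -mulmxA dot_mulmx trmxK enorm_sq.
apply: (@eq_integ _ _ _ (fun s => \sum_k ((C k s)^T *m C k s) i j)).
  by move=> s _; rewrite summxE.
exact: integ_sum.
Qed.

Lemma C_integ i (z : 'cV[R]_N) : integ w w' (fun s => enorm (C i s *m z) ^+ 2).
Proof.
apply: (@eq_integ _ _ _ (fun s => dot z (((C i s)^T *m C i s) *m z))).
  by move=> s _; rewrite -mulmxA -dot_mulmx enorm_sq.
exact: integ_dot.
Qed.

Lemma D_integ (z : 'cV[R]_n) : integ w w' (fun s => enorm ((D s)^T *m z) ^+ 2).
Proof.
apply: (@eq_integ _ _ _ (fun s => dot z (laplacian (D s) *m z))).
  by move=> s _; rewrite /laplacian -mulmxA -{1}[D s]trmxK -dot_mulmx enorm_sq.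
exact: integ_dot.
Qed.

Lemma Lambda_integ (x : 'cV[R]_(n * N)) :
  integ w w' (fun s => enorm (Lambda alpha (C^~ s) (D s) *m x) ^+ 2).
Proof.
apply: (@eq_integ _ _ _ (fun s => \sum_i enorm (C i s *m agent x i) ^+ 2
  + alpha * \sum_c enorm ((D s)^T *m coord x c) ^+ 2)).
  by move=> s _; rewrite enorm_Lambda // ltW.
apply: integD; first by apply: integ_sum => i; exact: C_integ.
by apply: integZ; apply: integ_sum => c; exact: D_integ.
Qed.

(** Split [x] into its average [m] over the agents and the deviations [y i] from
    it. The graph Laplacian sees the deviations; the regressors see the average,
    up to cross terms with the deviations. With [s] the share of the average in
    [|x|^2], the two lower bounds are the two members of the maximum defining
    [iota2_lo], up to the factor [|x|^2]. *)
Lemma excitation (x : 'cV[R]_(n * N)) :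
  i2lo * enorm x ^+ 2 <=
  segint w w' (fun s => enorm (Lambda alpha (C^~ s) (D s) *m x) ^+ 2).
Proof.
have [->|x0] := eqVneq x 0.
  by rewrite enorm0 expr0n mulr0; apply: segint_ge0 => s _; exact: sqr_ge0.
set J := segint w w' _.
pose m : 'cV[R]_N := \col_c ((\sum_i coord x c i 0) / n%:R).
pose y i := agent x i - m.
pose X := enorm x ^+ 2; pose Y2 := \sum_i enorm (y i) ^+ 2.
have X0 : 0 < X by rewrite exprn_gt0 // lt_neqAle eq_sym enorm_eq0 x0 enorm_ge0.
have Y20 : 0 <= Y2 by apply: sumr_ge0 => i _; exact: sqr_ge0.
have XE : X = n%:R * enorm m ^+ 2 + Y2.
  rewrite /X /Y2 enorm_agent.
  have sm : \sum_i agent x i = n%:R *: m.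
    apply/colP => c; rewrite !mxE mulrC divfK ?gt_eqF // summxE.
    by apply: eq_bigr => i _; rewrite !mxE.
  have -> : \sum_i enorm (y i) ^+ 2 =
     \sum_i (enorm (agent x i) ^+ 2 - 2 * dot (agent x i) m + enorm m ^+ 2).
    by apply: eq_bigr => i _; rewrite enormD_sq dotNr enormN mulrN.
  rewrite big_split sumrB /= sumr_const card_ord -[enorm m ^+ 2 *+ n]mulr_natl -mulr_sumr.
  by rewrite -dot_suml sm dotZl -enorm_sq; ring.
have JE : J = segint w w' (fun s => \sum_i enorm (C i s *m agent x i) ^+ 2)
   + alpha * segint w w' (fun s => \sum_c enorm ((D s)^T *m coord x c) ^+ 2).
  rewrite -segintZ; last by apply: integ_sum => c; exact: D_integ.
  rewrite -segintD; [|by apply: integ_sum => i; exact: C_integ|]; last first.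
    by apply: integZ; apply: integ_sum => c; exact: D_integ.
  by apply: eq_segint => s _; rewrite enorm_Lambda // ltW.
have JC0 : 0 <= segint w w' (fun s => \sum_i enorm (C i s *m agent x i) ^+ 2).
  by apply: segint_ge0 => s _; apply: sumr_ge0 => i _; exact: sqr_ge0.
have JD0 : 0 <= segint w w' (fun s => \sum_c enorm ((D s)^T *m coord x c) ^+ 2).
  by apply: segint_ge0 => s _; apply: sumr_ge0 => i _; exact: sqr_ge0.
have J1 : alpha * lam * Y2 <= J.
  rewrite JE -mulrA.
  apply: (@le_trans _ _ (alpha *
     segint w w' (fun s => \sum_c enorm ((D s)^T *m coord x c) ^+ 2))).
    rewrite ler_wpM2l ?(ltW alpha_gt0) // segint_sum => [|c]; last exact: D_integ.
    have -> : Y2 = X - n%:R * enorm m ^+ 2 by rewrite XE; ring.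
    rewrite /X enorm_coord [enorm m ^+ 2]enorm_sq dotE mulr_sumr -sumrB mulr_sumr.
    apply: ler_sum => c _.
    rewrite enorm_sq mxE -expr2; apply: le_trans (laplacian_window _) _.
    rewrite le_eqVlt; apply/orP; left; apply/eqP; apply: eq_segint => s _.
    by rewrite /laplacian -mulmxA -{1}[D s]trmxK -dot_mulmx enorm_sq.
  by rewrite lerDr.
have J2 : i1lo * enorm m ^+ 2
    - 2 * r2 * T * (enorm m * (Num.sqrt n%:R * Num.sqrt Y2)) <= J.
  rewrite JE.
  apply: (@le_trans _ _ (segint w w' (fun s =>
    \sum_i enorm (C i s *m agent x i) ^+ 2))); last first.
    by rewrite lerDl mulr_ge0 // ltW.
  set K := _ * (_ * _).
  have -> : K = (2 * r2 * (enorm m * (Num.sqrt n%:R * Num.sqrt Y2))) * (w' - w).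
    by rewrite /K; ring.
  rewrite -(segint_cst _ ww).
  apply: (@le_trans _ _ (segint w w' (fun s => \sum_i enorm (C i s *m m) ^+ 2)
     - segint w w' (fun=> (2 * r2 * (enorm m * (Num.sqrt n%:R * Num.sqrt Y2)))))).
    by rewrite lerD2r; exact: gram_window.
  have iC : integ w w' (fun s => \sum_i enorm (C i s *m m) ^+ 2).
    by apply: integ_sum => i; exact: C_integ.
  rewrite -segintB //; last exact: integ_cst.
  apply: le_segint.
  - by apply: integB => //; exact: integ_cst.
  - by apply: integ_sum => i; exact: C_integ.
  move=> s hs; rewrite lerBlDr.
  apply: (@le_trans _ _ (\sum_i (enorm (C i s *m agent x i) ^+ 2 +
    2 * r2 * (enorm m * enorm (y i))))).
    apply: ler_sum => i _.
    have -> : agent x i = m + y i by rewrite addrC subrK.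
    rewrite mulmxDr enormD_sq.
    have h1 := norm_dot_le (C i s *m m) (C i s *m y i).
    have h2 : enorm (C i s *m m) * enorm (C i s *m y i) <= r2 * (enorm m * enorm (y i)).
      rewrite -(@ler_pXn2r _ 2) // ?nnegrE ?mulr_ge0 ?enorm_ge0 ?(ltW r2_gt0) //.
      have e1 := enorm_gram_le m (C_le i hs).
      have e2 := enorm_gram_le (y i) (C_le i hs).
      rewrite exprMn.
      have -> : (r2 * (enorm m * enorm (y i))) ^+ 2 =
         (r2 * enorm m ^+ 2) * (r2 * enorm (y i) ^+ 2) by ring.
      by apply: ler_pM; rewrite ?sqr_ge0.
    have h3 := sqr_ge0 (enorm (C i s *m y i)).
    move: h1; rewrite ler_norml => /andP[h1 _]; lra.
  rewrite big_split /= lerD2l -mulr_sumr ler_wpM2l ?mulr_ge0 ?(ltW r2_gt0) //.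
  rewrite -mulr_sumr ler_wpM2l ?enorm_ge0 //; exact: sum_le_sqrt.
pose s := n%:R * enorm m ^+ 2 / X.
have sE : 1 - s = Y2 / X.
  have -> : Y2 = X - n%:R * enorm m ^+ 2 by rewrite XE addrC addKr.
  by rewrite /s; field; exact: lt0r_neq0.
(* The vector of R^N at which the minimum is tested. *)
pose v := Num.sqrt (n%:R / X) *: m.
have vE : enorm v ^+ 2 = s.
  rewrite enormZ exprMn real_normK ?num_real // sqr_sqrtr ?divr_ge0 ?(ltW X0) //.
  by rewrite /s mulrAC.
have s1 : s <= 1 by rewrite -subr_ge0 sE divr_ge0 // ltW.
have := @iota2_lo_le v; rewrite vE => /(_ s1) => h.
rewrite -/X -ler_pdivlMr //; apply: le_trans h _.
rewrite ge_max sE; apply/andP; split.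
  by rewrite mulrA ler_wpM2r // invr_ge0 ltW.
rewrite ler_pdivlMr //; apply: le_trans J2.
have -> : Num.sqrt (s * (Y2 / X)) = enorm m * (Num.sqrt n%:R * Num.sqrt Y2) / X.
  have -> : s * (Y2 / X) = (enorm m * (Num.sqrt n%:R * Num.sqrt Y2) / X) ^+ 2.
    rewrite /s !exprMn (sqr_sqrtr (ltW nR)) (sqr_sqrtr Y20).
    by field; exact: lt0r_neq0.
  by rewrite sqrtr_sqr ger0_norm // divr_ge0 ?(ltW X0) ?mulr_ge0 ?enorm_ge0 ?sqrtr_ge0.
rewrite le_eqVlt; apply/orP; left; apply/eqP.
by rewrite /s; field; rewrite !lt0r_neq0.
Qed.

End Excitation.

(** * Constants and the matrix inequality *)

Section Constants.
Context {R : realType}.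
Implicit Types a b f r : R.

Lemma iota3_lo_ge0 n N T r1 r2 r3 i1lo lam alpha :
  0 <= iota2_up T r2 r3 alpha ->
  0 <= iota3_lo n N T r1 r2 r3 i1lo lam alpha :> R.
Proof.
move=> b0; rewrite /iota3_lo; case: ifP => _; last exact: sqr_ge0.
by rewrite divr_ge0 ?sqr_ge0 // mulr_ge0.
Qed.

(** Rationalizing the difference of square roots turns [iota3_lo] into
    [(a / (sqrt (b - a + f a) + sqrt b))^2] for every [f], and the square of
    the sum is at least the sum of the squares. *)
Lemma iota3_lo_bounds n N T r1 r2 r3 i1lo lam alpha
    (a := iota2_lo n N T r2 i1lo lam alpha) (b := iota2_up T r2 r3 alpha)
    (f := phi1 r1 b) :
  0 < a -> a <= b ->
  0 < iota3_lo n N T r1 r2 r3 i1lo lam alpha /\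
  iota3_lo n N T r1 r2 r3 i1lo lam alpha * (1 + f) <= a :> R.
Proof.
rewrite /iota3_lo -/a -/b -/f; move=> a0 ab; have b0 := lt_le_trans a0 ab.
have f0 : 0 <= f by rewrite /f /phi1 divr_ge0 // mulr_ge0 ?sqr_ge0.
move: a b f a0 ab b0 f0 => a b f a0 ab b0 f0.
case: eqP => [->|/eqP f1].
  split; first by rewrite divr_gt0 ?exprn_gt0 // mulr_gt0.
  rewrite mulrAC ler_pdivrMr ?mulr_gt0 //; nra.
have u2 : 0 <= b - a + f * a by rewrite addr_ge0 ?subr_ge0 // mulr_ge0 // ltW.
set u := Num.sqrt (b - a + f * a); set v := Num.sqrt b.
have uE : u ^+ 2 = b - a + f * a by rewrite sqr_sqrtr.
have vE : v ^+ 2 = b by rewrite sqr_sqrtr // ltW.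
have u0 : 0 <= u by rewrite sqrtr_ge0.
have v0 : 0 < v by rewrite sqrtr_gt0.
clearbody u v.
have uv0 : 0 < u + v by rewrite ltr_wpDl.
have f10 : f - 1 != 0 by rewrite subr_eq0.
have -> : (u - v) / (f - 1) = a / (u + v).
  apply/eqP; rewrite (eqr_div _ _ f10 (lt0r_neq0 uv0)); apply/eqP.
  have -> : (u - v) * (u + v) = u ^+ 2 - v ^+ 2 by ring.
  by rewrite uE vE; ring.
split; first by rewrite exprn_gt0 // divr_gt0.
rewrite expr_div_n mulrAC ler_pdivrMr ?exprn_gt0 //.
have : a * (1 + f) <= (u + v) ^+ 2.
  have -> : (u + v) ^+ 2 = u ^+ 2 + v ^+ 2 + 2 * (u * v) by ring.
  rewrite uE vE; have : 0 <= u * v by rewrite mulr_ge0 // ltW.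
  nra.
nra.
Qed.

(** Here [p], [q], [s] stand for the L2 norms of [xi], [e], [v] on a window and
    [X] for a bound of [|x|] there. For [c1 = c2 T], in which case the claim is
    sharpest, put [y = c1 s / (sqrt g2 c2 sqrt T)]; the claim divided by [c2 T]
    is [2 y X <= p^2 + q^2 + 4 y^2 / i3]. It follows by completing squares
    because [i3 (1 + (r b)^2 / 2) <= a <= b]. *)
Lemma window_algebra (a b i3 r T c1 c2 g2 p q s X : R) :
  0 < a -> a <= b -> 0 < i3 -> i3 * (1 + r ^+ 2 * b ^+ 2 / 2) <= a ->
  0 < T -> 0 < c2 -> c2 * T <= c1 -> 0 < g2 -> Num.sqrt g2 <= r ->
  0 <= q -> 0 <= s ->
  Num.sqrt a * X <= p + r * b * q + Num.sqrt (b * T) * s ->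
  2 * c1 / Num.sqrt g2 * (X * (Num.sqrt T * s)) <=
  c2 * T * p ^+ 2 + c1 * q ^+ 2 + 4 * c1 ^+ 2 / (c2 * i3 * g2) * s ^+ 2.
Proof.
move=> a0 ab i30 hi3 T0 c20 hc g20 hg q0 s0.
have b0 := lt_le_trans a0 ab.
rewrite sqrtrM ?(ltW b0) //.
have sa0 : 0 < Num.sqrt a by rewrite sqrtr_gt0.
have sb0 : 0 < Num.sqrt b by rewrite sqrtr_gt0.
have sT0 : 0 < Num.sqrt T by rewrite sqrtr_gt0.
have sg0 : 0 < Num.sqrt g2 by rewrite sqrtr_gt0.
have sab : Num.sqrt a <= Num.sqrt b by rewrite ler_wsqrtr.
have saE := sqr_sqrtr (ltW a0); have sbE := sqr_sqrtr (ltW b0).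
have sTE := sqr_sqrtr (ltW T0); have sgE := sqr_sqrtr (ltW g20).
move: (Num.sqrt a) (Num.sqrt b) (Num.sqrt T) (Num.sqrt g2) sa0 sb0 sT0 sg0 sab
  hg saE sbE sTE sgE => sa sb sT sg sa0 sb0 sT0 sg0 sab hg saE sbE sTE sgE.
subst a b T g2 => hX.
have c1p : 0 < c1 by apply: lt_le_trans hc; rewrite mulr_gt0 // exprn_gt0.
have r0 : 0 < r by apply: lt_le_trans hg.
(* z = y / sqrt a *)
pose z := c1 * s / (sg * c2 * sT * sa).
have z0 : 0 <= z.
  rewrite /z divr_ge0 ?mulr_ge0 //; exact: ltW.
have sE : c1 * s = z * (sg * c2 * sT * sa).
  by rewrite /z divfK // !mulf_neq0 // lt0r_neq0.
pose rho := r * sb ^+ 2.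
have rho0 : 0 < rho by rewrite mulr_gt0 // exprn_gt0.
have h1 : sb * sT * s <= rho * z.
  rewrite -(ler_pM2l c1p).
  have -> : c1 * (sb * sT * s) = (sg * sa) * (c2 * sT ^+ 2) * (sb * z).
    have -> : c1 * (sb * sT * s) = sb * sT * (c1 * s) by ring.
    by rewrite sE; ring.
  have -> : c1 * (rho * z) = (r * sb) * c1 * (sb * z) by rewrite /rho; ring.
  apply: ler_wpM2r; first by rewrite mulr_ge0 // ltW.
  apply: ler_pM => //; [by rewrite mulr_ge0 // ltW|by rewrite mulr_ge0 ?sqr_ge0 // ltW|].
  by apply: ler_pM => //; exact: ltW.
have h2 : 2 * z * (sa * X) <= p ^+ 2 + q ^+ 2 + 2 * (1 + rho ^+ 2) * z ^+ 2.
  have : 2 * z * (sa * X) <= 2 * z * (p + rho * q + rho * z).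
    apply: ler_wpM2l; first by rewrite mulr_ge0.
    by apply: le_trans hX _; rewrite lerD2l.
  move/le_trans; apply.
  have := sqr_ge0 (p - z); have := sqr_ge0 (q - rho * z).
  have : 0 <= (1 - rho) ^+ 2 * z ^+ 2 by rewrite mulr_ge0 ?sqr_ge0.
  nra.
have -> : 2 * c1 / sg * (X * (sT * s)) = c2 * sT ^+ 2 * (2 * z * (sa * X)).
  have -> : 2 * c1 / sg * (X * (sT * s)) = 2 / sg * X * sT * (c1 * s).
    by field; exact: lt0r_neq0.
  by rewrite sE; field; exact: lt0r_neq0.
have -> : 4 * c1 ^+ 2 / (c2 * i3 * sg ^+ 2) * s ^+ 2 =
    c2 * sT ^+ 2 * (4 * sa ^+ 2 / i3 * z ^+ 2).
  have -> : 4 * c1 ^+ 2 / (c2 * i3 * sg ^+ 2) * s ^+ 2 =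
    4 / (c2 * i3 * sg ^+ 2) * (c1 * s) ^+ 2.
    by field; rewrite !lt0r_neq0.
  by rewrite sE; field; rewrite !lt0r_neq0.
have cT0 : 0 < c2 * sT ^+ 2 by rewrite mulr_gt0 // exprn_gt0.
have h3 : c2 * sT ^+ 2 * q ^+ 2 <= c1 * q ^+ 2 by rewrite ler_wpM2r ?sqr_ge0.
have h4 : 2 * (1 + rho ^+ 2) <= 4 * sa ^+ 2 / i3.
  rewrite ler_pdivlMr //.
  have -> : rho ^+ 2 = r ^+ 2 * (sb ^+ 2) ^+ 2 by rewrite /rho exprMn.
  lra.
have h5 : 2 * (1 + rho ^+ 2) * z ^+ 2 <= 4 * sa ^+ 2 / i3 * z ^+ 2.
  by rewrite ler_wpM2r ?sqr_ge0.
have h6 : c2 * sT ^+ 2 * (2 * z * (sa * X)) <=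
   c2 * sT ^+ 2 * (p ^+ 2 + q ^+ 2 + 4 * sa ^+ 2 / i3 * z ^+ 2).
  by rewrite ler_pM2l //; apply: le_trans h2 _; rewrite lerD2l.
apply: (le_trans h6); rewrite !mulrDr; lra.
Qed.

End Constants.

Section LMI.
Context {R : realType}.

Lemma dot_block_mx m k (A : 'M[R]_m) B C (D : 'M[R]_k) u v :
  dot (col_mx u v) (block_mx A B C D *m col_mx u v) =
  dot u (A *m u) + dot u (B *m v) + (dot v (C *m u) + dot v (D *m v)).
Proof. by rewrite mul_block_col dot_col_mx !dotDr. Qed.

Lemma lemx0_quad m (A : 'M[R]_m) : lemx A 0 -> forall x, dot x (A *m x) <= 0.
Proof.
move=> [_ h] x; have := h x.
by rewrite sub0r -mulmxA mulNmx -/(dot _ _) dotNr oppr_ge0.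
Qed.

Variables (q k p r : nat) (T c1 c2 g1 g2 g i3up i3lo r4 : R).
Variables (D1 : 'M[R]_(k, r)) (D2 : 'M[R]_(q, r)).
Variables (Q : 'M[R]_(p, q)) (W : 'M[R]_(p, r)).
Hypotheses (c2_gt0 : 0 < c2) (i3lo_ge0 : 0 <= i3lo) (g2_gt0 : 0 < g2).
Hypotheses (g1_gt0 : 0 < g1) (r4_ge0 : 0 <= r4).
Hypothesis (WW : W^T *m W = 1%:M).
Hypothesis LMI : lmi T c1 c2 g1 g2 g i3up i3lo r4 D1 D2 Q W.

Let enormW d : enorm (W *m d) ^+ 2 = enorm d ^+ 2.
Proof. by rewrite !enorm_sq dot_mulmx mulmxA WW mul1mx. Qed.

(** The quadratic form on vectors whose state block is zero; that block is
    decoupled from the others. *)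
Lemma lmi_form xi z d w :
  (c2 * T - c1) * enorm xi ^+ 2 + 2 * dot z (Q *m xi) - enorm z ^+ 2
  + 2 * dot z (W *m d) + dot d (phi44 c1 c2 g1 g i3up i3lo r4 D1 D2 *m d)
  - 2 * (2 * c1 / Num.sqrt (c2 * i3lo)) * dot w (D1 *m d)
  - g2 * enorm w ^+ 2 <= 0.
Proof.
have := lemx0_quad LMI (col_mx (col_mx xi (col_mx 0 (col_mx z d))) w).
rewrite dot_block_mx -[dot w (_^T *m _)]dot_mulmx (dotC (_ *m w)).
rewrite /Phi11_OE !dot_block_mx /Phi12 !mul_row_col !mul_col_mx !mul0mx !dot_col_mx.
rewrite !(addr0, add0r, dot0l, dot0r) -!scalemxAl !mul_scalar_mx !dotZr.
rewrite -[dot xi (Q^T *m z)]dot_mulmx (dotC (Q *m xi) z).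
rewrite -[dot d (W^T *m z)]dot_mulmx (dotC (W *m d) z).
rewrite -[dot d (D1^T *m w)]dot_mulmx (dotC (D1 *m d) w).
rewrite !enorm_sq. lra.
Qed.

(** The form is maximal in [z] at [z = Q xi + W d]; [Q xi] and [W d] are tested
    separately. *)
Lemma lmi_output xi : enorm (Q *m xi) ^+ 2 <= (c1 - c2 * T) * enorm xi ^+ 2.
Proof.
have := lmi_form xi (Q *m xi) 0 0.
rewrite !mulmx0 !(dotC _ 0) !dot0l enorm0 expr0n /= !mulr0 -!enorm_sq. lra.
Qed.

(** Test at [z = W d] and at the [w] that maximizes the form, which is the Schur
    complement of the last block. *)
Lemma lmi_input d :
  c1 * enorm (D2 *m d) ^+ 2 + 4 * c1 ^+ 2 / (c2 * i3lo * g2) * enorm (D1 *m d) ^+ 2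
  + enorm d ^+ 2 <= g * enorm d ^+ 2.
Proof.
set kk := 2 * c1 / Num.sqrt (c2 * i3lo).
have kk2 : kk ^+ 2 = 4 * c1 ^+ 2 / (c2 * i3lo).
  rewrite /kk expr_div_n sqr_sqrtr ?mulr_ge0 ?(ltW c2_gt0) //.
  by congr (_ / _); ring.
have := lmi_form 0 (W *m d) d (- (kk / g2) *: (D1 *m d)).
rewrite -/kk enorm0 expr0n mulr0 mulmx0 (dotC _ 0) !dot0l -!enorm_sq enormW.
rewrite dotZl enormZ exprMn -!enorm_sq real_normK ?num_real //.
rewrite /phi44 mulmxBl mulmxDl -!scalemxAl dotDr dotNr dotDr !dotZr mul_scalar_mx dotZr.
rewrite -!mulmxA -![dot d (_^T *m _)]dot_mulmx -!enorm_sq.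
have -> : 4 * c1 ^+ 2 / (c2 * i3lo * g2) = kk ^+ 2 / g2.
  by rewrite kk2 [in LHS]invfM mulrA.
have -> : g2 * ((- (kk / g2)) ^+ 2 * enorm (D1 *m d) ^+ 2) = kk ^+ 2 / g2 * enorm (D1 *m d) ^+ 2.
  by field; exact: lt0r_neq0.
have -> : 2 * kk * (- (kk / g2) * enorm (D1 *m d) ^+ 2) =
    - (2 * (kk ^+ 2 / g2 * enorm (D1 *m d) ^+ 2)).
  by field; exact: lt0r_neq0.
have E1 : 0 <= 8 * c2 * i3up ^+ 2 / i3lo * enorm (D1 *m d) ^+ 2.
  move: (sqr_ge0 i3up) (sqr_ge0 (enorm (D1 *m d))).
  move: (i3up ^+ 2) (enorm (D1 *m d) ^+ 2) => U V U0 V0.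
  by rewrite !mulr_ge0 ?invr_ge0 ?(ltW c2_gt0).
have E2 : 0 <= 8 * c2 * i3up ^+ 2 * r4 * g1 / i3lo * enorm (D2 *m d) ^+ 2.
  move: (sqr_ge0 i3up) (sqr_ge0 (enorm (D2 *m d))).
  move: (i3up ^+ 2) (enorm (D2 *m d) ^+ 2) => U V U0 V0.
  by rewrite !mulr_ge0 ?invr_ge0 ?(ltW c2_gt0) ?(ltW g1_gt0).
lra.
Qed.

End LMI.

(** * Measurability *)

Section Measurability.
Context {R : realType}.
Local Notation D0 := [set` `[(0:R), +oo[].
Local Notation mfun f := (measurable_fun D0 f).

Lemma measurable_fun_piecewise (ne : R -> nat) (F : R -> R) (f : nat -> R -> R) :
  measurable_fun D0 ne -> (forall m, measurable_fun D0 (f m)) ->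
  (forall t, 0 <= t -> F t = f (ne t) t) -> measurable_fun D0 F.
Proof.
move=> mne mf Ff.
pose E m : set R := D0 `&` ne @^-1` [set m].
have mE m : measurable (E m) by apply: mne.
have -> : D0 = \bigcup_m E m.
  apply/seteqP; split=> [t t0|t [m _ []//]].
  by exists (ne t).
apply/measurable_fun_bigcup => // m.
apply: (@eq_measurable_fun _ _ _ _ _ (f m)).
  move=> t; rewrite inE => -[t0 /= <-]; rewrite Ff //.
  by move: t0; rewrite /= in_itv /= andbT.
apply: measurable_funS (mf m); [exact: measurable_itv | by move=> t []].
Qed.

Lemma eq_meas (f g : R -> R) : (forall t, g t = f t) -> mfun f -> mfun g.
Proof. by move=> /funext ->. Qed.

Lemma meas_sum (J : finType) (F : J -> R -> R) :
  (forall j, measurable_fun D0 (F j)) ->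
  measurable_fun D0 (fun t => \sum_j F j t).
Proof. by move=> mF; apply: measurable_sum. Qed.

Section Operations.
Variables a b c : nat.

Lemma meas_cst (A : 'M[R]_(a, b)) : measurable_mx (fun=> A).
Proof. by move=> i j; exact: measurable_cst. Qed.

Lemma meas_mul (A : R -> 'M[R]_(a, b)) (B : R -> 'M[R]_(b, c)) :
  measurable_mx A -> measurable_mx B -> measurable_mx (fun t => A t *m B t).
Proof.
move=> mA mB i j.
apply: (@eq_meas (fun t => \sum_k A t i k * B t k j)) => [t|]; first by rewrite mxE.
by apply: meas_sum => k; apply: measurable_funM; [exact: mA|exact: mB].
Qed.

Lemma meas_add (A B : R -> 'M[R]_(a, b)) :
  measurable_mx A -> measurable_mx B -> measurable_mx (fun t => A t + B t).
Proof.
move=> mA mB i j; apply: (@eq_meas (fun t => A t i j + B t i j)) => [t|].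
  by rewrite mxE.
by apply: measurable_funD; [exact: mA|exact: mB].
Qed.

Lemma meas_opp (A : R -> 'M[R]_(a, b)) :
  measurable_mx A -> measurable_mx (fun t => - A t).
Proof.
move=> mA i j; apply: (@eq_meas (fun t => - A t i j)) => [t|]; first by rewrite mxE.
by apply: measurableT_comp => //; exact: mA.
Qed.

Lemma meas_tr (A : R -> 'M[R]_(a, b)) :
  measurable_mx A -> measurable_mx (fun t => (A t)^T).
Proof.
by move=> mA i j; apply: (@eq_meas (fun t => A t j i)) => [t|]; rewrite ?mxE.
Qed.

End Operations.

Lemma meas_dot m (x y : R -> 'cV[R]_m) : measurable_mx x -> measurable_mx y ->
  measurable_fun D0 (fun t => dot (x t) (y t)).
Proof. by move=> mx my; apply: meas_mul => //; exact: meas_tr. Qed.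

Lemma meas_Lambda n N Ny m alpha (C : 'I_n -> R -> 'M[R]_(Ny, N))
    (D : R -> 'M[R]_(n, m)) :
  (forall i, measurable_mx (C i)) -> measurable_mx D ->
  measurable_mx (fun t => Lambda alpha (C^~ t) (D t)).
Proof.
move=> mC mD i j; rewrite /Lambda.
case: (split_ordP i) => k ->.
  apply: (@eq_meas (fun t => \sum_l
    (delta_mx l l : 'M[R]_n) (mxtens_unindex k).1 (mxtens_unindex j).1
    * C l t (mxtens_unindex k).2 (mxtens_unindex j).2)) => [t|].
    by rewrite col_mxEu /blkdiag summxE; apply: eq_bigr => l _; rewrite !mxE.
  apply: meas_sum => l; apply: measurable_funM => //; exact: mC.
apply: (@eq_meas (fun t => Num.sqrt alpha * (D t (mxtens_unindex j).1 (mxtens_unindex k).1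
    * (1%:M : 'M[R]_N) (mxtens_unindex k).2 (mxtens_unindex j).2))) => [t|].
  by rewrite col_mxEd !mxE.
by apply: measurable_funM => //; apply: measurable_funM => //; exact: mD.
Qed.

(** Measurability of an expression in a matrix of varying size reduces to
    matrices of fixed size: on the set where there are [m] columns, the matrix
    agrees with the one obtained by reading [m] columns at all times. *)
Lemma meas_dep n (ne : R -> nat) (D : forall t, 'M[R]_(n, ne t))
    (Phi : forall m, R -> 'M[R]_(n, m) -> R) :
  measurable_mxdep D ->
  (forall m (A : R -> 'M[R]_(n, m)), measurable_mx A ->
     measurable_fun D0 (fun t => Phi m t (A t))) ->
  measurable_fun D0 (fun t => Phi (ne t) t (D t)).
Proof.
move=> [mne mD] mPhi.
pose A m t : 'M[R]_(n, m) :=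
  \matrix_(i, e) oapp (D t i) 0 (insub (e : nat) : option 'I_(ne t)).
apply: (@measurable_fun_piecewise ne _ (fun m t => Phi m t (A m t))) => //.
  move=> m; apply: mPhi => i e; apply: eq_meas (mD i e) => t; by rewrite mxE.
move=> t _; congr (Phi _ _ _); apply/matrixP => i e; rewrite mxE.
by rewrite valK.
Qed.

End Measurability.

(** * The estimate on one window *)

Section Gain.
Context {R : realType}.
Variables (k : nat) (Gam : 'M[R]_k) (c : R).
Hypotheses (c_gt0 : 0 < c) (Gam_sym : Gam^T = Gam).
Hypothesis Gam_lo : lemx c%:M Gam.

Lemma gain_lo y : c * enorm y ^+ 2 <= dot y (Gam *m y).
Proof.
have [_ /(_ y)] := Gam_lo; rewrite -mulmxA -/(dot _ _) mulmxBl dotDr dotNr.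
by rewrite mul_scalar_mx dotZr -enorm_sq subr_ge0.
Qed.

Lemma gain_expands y : c * enorm y <= enorm (Gam *m y).
Proof.
have [->|y0] := eqVneq y 0; first by rewrite enorm0 mulr0 enorm_ge0.
have ey : 0 < enorm y by rewrite lt_neqAle eq_sym enorm_eq0 y0 enorm_ge0.
rewrite -(ler_pM2l ey); apply: le_trans (dot_le_enorm _ _).
by apply: le_trans (gain_lo y); rewrite expr2 mulrCA.
Qed.

Lemma gain_unit : Gam \in unitmx.
Proof.
rewrite unitmxE unitfE; apply/det0P => -[u u0 uG].
have : Gam *m u^T = 0 by rewrite -Gam_sym -trmx_mul uG trmx0.
move=> h; have := gain_expands u^T; rewrite h enorm0.
rewrite pmulr_rle0 // => h0; move: u0; rewrite -(inj_eq trmx_inj) trmx0 -enorm_eq0.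
by rewrite eq_le h0 enorm_ge0.
Qed.

Lemma gain_inv_le y : enorm (invmx Gam *m y) <= enorm y / c.
Proof.
rewrite ler_pdivlMr // mulrC; apply: le_trans (gain_expands _) _.
by rewrite mulKVmx // gain_unit.
Qed.

Lemma gain_inv_ge0 y : 0 <= dot y (invmx Gam *m y).
Proof.
have {1}-> : y = Gam *m (invmx Gam *m y) by rewrite mulKVmx // gain_unit.
rewrite dotC; apply: le_trans (gain_lo _).
by rewrite mulr_ge0 ?sqr_ge0 // ltW.
Qed.

Lemma gain_le_opnorm : (0 < k)%N -> c <= opnorm Gam.
Proof.
move=> k0; pose y : 'cV[R]_k := const_mx 1.
have y0 : 0 < enorm y.
  rewrite lt_neqAle eq_sym enorm_eq0 enorm_ge0 andbT; apply/eqP.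
  by move/matrixP/(_ (Ordinal k0) 0); rewrite !mxE => /eqP; rewrite oner_eq0.
rewrite -(ler_pM2r y0); apply: le_trans (gain_expands y) _.
exact: enorm_mulmx_le.
Qed.

End Gain.

Section Window.
Context {R : realType}.
Variables (k : nat) (q : R -> nat) (Gam : 'M[R]_k).
Variables (L : forall t, 'M[R]_(q t, k)) (e : forall t, 'cV[R]_(q t)).
Variables (v x f : R -> 'cV[R]_k).
Variables (w T a rho : R).
Local Notation w' := (w + T).
Hypotheses (T_gt0 : 0 < T) (rho_ge0 : 0 <= rho).
Hypothesis f_integ : forall i, integ w w' (fun s => f s i 0).
Hypothesis xE : forall i t, w <= t <= w' ->
  x t i 0 = x w i 0 + segint w t (fun s => f s i 0).
Hypothesis fE : forall t, w <= t <= w' ->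
  f t = - (Gam *m ((L t)^T *m e t)) - v t.
Hypothesis L_le : forall t y, w <= t <= w' ->
  enorm (L t *m y) ^+ 2 <= rho * enorm y ^+ 2.
Hypothesis nxi_integ : integ w w' (fun s => enorm (L s *m x s)).
Hypothesis ne_integ : integ w w' (fun s => enorm (e s)).
Hypothesis nv_integ : integ w w' (fun s => enorm (v s)).
Hypothesis xi_integ : integ w w' (fun s => enorm (L s *m x s) ^+ 2).
Hypothesis e_integ : integ w w' (fun s => enorm (e s) ^+ 2).
Hypothesis v_integ : integ w w' (fun s => enorm (v s) ^+ 2).

Local Notation Pxi := (segint w w' (fun s => enorm (L s *m x s) ^+ 2)).
Local Notation Pe := (segint w w' (fun s => enorm (e s) ^+ 2)).
Local Notation Pv := (segint w w' (fun s => enorm (v s) ^+ 2)).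

Let ww : w <= w'. Proof. by rewrite lerDl ltW. Qed.
Let wT : w' - w = T. Proof. by rewrite addrAC subrr add0r. Qed.

Lemma segint_norm_le (F : R -> R) : integ w w' F -> integ w w' (fun s => F s ^+ 2) ->
  segint w w' F <= Num.sqrt T * Num.sqrt (segint w w' (fun s => F s ^+ 2)).
Proof.
move=> hF hF2; rewrite -sqrtrM ?(ltW T_gt0) //.
apply: le_trans (ler_norm _) _; rewrite -sqrtr_sqr ler_wsqrtr //.
by have := segint_sqr_le ww hF hF2; rewrite wT.
Qed.

Let K := opnorm Gam * Num.sqrt rho * segint w w' (fun s => enorm (e s))
         + segint w w' (fun s => enorm (v s)).

Lemma x_coordB i s t : w <= s -> s <= t -> t <= w' ->
  x t i 0 - x s i 0 = segint s t (fun s => f s i 0).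
Proof.
move=> ws st tw.
rewrite (xE i (t := t)) ?(le_trans ws st) // (xE i (t := s)) ?ws ?(le_trans st tw) //.
rewrite (segint_split (c := s) _ ws st); last exact: integS (f_integ i).
by ring.
Qed.

(** The equation in the form [x' = - Gam L^T e - v] bounds the speed of [x] by
    [|e|] and [|v|]. *)
Lemma dot_f_le y s : w <= s <= w' -> dot y (f s) <=
  enorm y * (opnorm Gam * Num.sqrt rho * enorm (e s) + enorm (v s)).
Proof.
move=> hs; apply: le_trans (dot_le_enorm _ _) _.
rewrite ler_wpM2l ?enorm_ge0 // fE //; apply: le_trans (enormD _ _) _.
rewrite !enormN lerD2r; apply: le_trans (enorm_mulmx_le _ _) _.
rewrite -mulrA; apply: ler_wpM2l; first exact: opnorm_ge0.
have h := enorm_trmx_le rho_ge0 (fun y => L_le y hs) (e s).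
rewrite -(@ler_pXn2r _ 2) // ?nnegrE ?mulr_ge0 ?enorm_ge0 ?sqrtr_ge0 //.
by rewrite exprMn (sqr_sqrtr rho_ge0).
Qed.

(** Scalar product of the increment [d = x t - x s] with itself: this reduces the
    norm of a vector integral to scalar integrals. *)
Lemma x_variation_lt s t : w <= s -> s <= t -> t <= w' ->
  enorm (x t - x s) <= K.
Proof.
move=> ws st tw; set d := x t - x s.
have [->|d0] := eqVneq d 0.
  rewrite enorm0 addr_ge0 //; last by apply: segint_ge0 => *; exact: enorm_ge0.
  rewrite mulr_ge0 ?mulr_ge0 ?opnorm_ge0 ?sqrtr_ge0 //.
  by apply: segint_ge0 => *; exact: enorm_ge0.
have ed : 0 < enorm d by rewrite lt_neqAle eq_sym enorm_eq0 d0 enorm_ge0.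
rewrite -(ler_pM2l ed) -expr2 enorm_sq.
have fi i : integ s t (fun s => f s i 0) by exact: integS (f_integ i).
have -> : dot d d = segint s t (fun z => dot d (f z)).
  rewrite (@eq_segint _ _ _ _ (fun z => \sum_i d i 0 * f z i 0)); last first.
    by move=> z _; rewrite dotE.
  rewrite segint_sum => [|i]; last exact: integZ.
  rewrite dotE; apply: eq_bigr => i _; rewrite segintZ //.
  by rewrite -(x_coordB i ws st tw) /d !mxE.
pose F z := enorm d * (opnorm Gam * Num.sqrt rho * enorm (e z) + enorm (v z)).
have iF : integ w w' F by apply/integZ/integD => //; exact: integZ.
have F0 z : 0 <= F z.
  by rewrite mulr_ge0 ?addr_ge0 ?mulr_ge0 ?mulr_ge0 ?opnorm_ge0 ?sqrtr_ge0 ?enorm_ge0.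
apply: (@le_trans _ _ (segint s t F)).
  apply: le_segint; [|exact: integS iF|].
    apply: (@eq_integ _ _ _ (fun z => \sum_i d i 0 * f z i 0)).
      by move=> z _; rewrite dotE.
    by apply: integ_sum => i; exact: integZ.
  by move=> z /andP[sz zt]; apply: dot_f_le; rewrite (le_trans ws sz) (le_trans zt tw).
have -> : enorm d * K = segint w w' F.
  rewrite /F segintZ; last by apply: integD => //; exact: integZ.
  by rewrite segintD //; [rewrite segintZ | exact: integZ].
rewrite (segint_split iF ws (le_trans st tw)) (segint_split (a := s) (c := t) _ st tw); last first.
  exact: integS iF.
by rewrite addrCA lerDl addr_ge0 // segint_ge0.
Qed.

Lemma x_variation s t : w <= s <= w' -> w <= t <= w' -> enorm (x t - x s) <= K.
Proof.
move=> /andP[ws sw] /andP[wt tw]; have [st|/ltW ts] := leP s t.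
  exact: x_variation_lt.
by rewrite -enormN opprB; exact: x_variation_lt.
Qed.

Hypothesis a_gt0 : 0 < a.
Hypothesis PE_integ : forall y, integ w w' (fun s => enorm (L s *m y) ^+ 2).
Hypothesis PE : forall y, a * enorm y ^+ 2 <= segint w w' (fun s => enorm (L s *m y) ^+ 2).

(** Excitation of the frozen state [x t], with [L s x t] compared to
    [L s x s]. *)
Lemma x_bound t : w <= t <= w' ->
  Num.sqrt a * enorm (x t) <= Num.sqrt Pxi + opnorm Gam * (T * rho) * Num.sqrt Pe
     + Num.sqrt (T * rho * T) * Num.sqrt Pv.
Proof.
move=> ht.
have K0 : 0 <= K by apply: le_trans (x_variation ht ht); exact: enorm_ge0.
have P0 (F : R -> R) : 0 <= segint w w' (fun s => F s ^+ 2).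
  by apply: segint_ge0 => *; exact: sqr_ge0.
pose k0 := Num.sqrt rho * K; have k00 : 0 <= k0 by rewrite mulr_ge0 ?sqrtr_ge0.
have le1 s : w <= s <= w' -> enorm (L s *m x t) <= enorm (L s *m x s) + k0.
  move=> hs; have -> : x t = x s + (x t - x s) by rewrite addrC subrK.
  rewrite mulmxDr; apply: le_trans (enormD _ _) _; rewrite lerD2l.
  rewrite -(@ler_pXn2r _ 2) // ?nnegrE ?enorm_ge0 //.
  apply: le_trans (L_le _ hs) _; rewrite exprMn (sqr_sqrtr rho_ge0) ler_wpM2l //.
  by rewrite lerXn2r ?nnegrE ?enorm_ge0 // x_variation.
have le2 : a * enorm (x t) ^+ 2 <= (Num.sqrt Pxi + Num.sqrt T * k0) ^+ 2.
  apply: le_trans (PE _) _.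
  apply: (@le_trans _ _ (segint w w' (fun s => enorm (L s *m x s) ^+ 2 +
      ((2 * k0) * enorm (L s *m x s) + k0 ^+ 2)))).
    apply: le_segint => //.
      by apply: integD => //; apply: integD (integ_cst _ _ _); exact: integZ.
    move=> s hs; have := le1 s hs; have := enorm_ge0 (L s *m x t); nra.
  rewrite segintD //; last by apply: integD (integ_cst _ _ _); exact: integZ.
  rewrite segintD; [|exact: integZ|exact: integ_cst].
  rewrite segintZ // segint_cst // wT.
  have h := segint_norm_le nxi_integ xi_integ.
  have h2 : 2 * k0 * segint w w' (fun s => enorm (L s *m x s)) <=
     2 * k0 * (Num.sqrt T * Num.sqrt Pxi).
    by rewrite ler_wpM2l // mulr_ge0.
  have hP := sqr_sqrtr (P0 (fun s => enorm (L s *m x s))).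
  have hT := sqr_sqrtr (ltW T_gt0).
  have -> : (Num.sqrt Pxi + Num.sqrt T * k0) ^+ 2 = Num.sqrt Pxi ^+ 2
      + 2 * k0 * (Num.sqrt T * Num.sqrt Pxi) + Num.sqrt T ^+ 2 * k0 ^+ 2 by ring.
  by rewrite hP hT; lra.
have le3 : Num.sqrt a * enorm (x t) <= Num.sqrt Pxi + Num.sqrt T * k0.
  rewrite -(@ler_pXn2r _ 2) // ?nnegrE ?mulr_ge0 ?addr_ge0 ?mulr_ge0 ?sqrtr_ge0 ?enorm_ge0 //.
  by rewrite exprMn (sqr_sqrtr (ltW a_gt0)).
apply: le_trans le3 _; rewrite -addrA lerD2l.
have he := segint_norm_le ne_integ e_integ; have hv := segint_norm_le nv_integ v_integ.
have hK : K <= opnorm Gam * Num.sqrt rho * (Num.sqrt T * Num.sqrt Pe)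
    + Num.sqrt T * Num.sqrt Pv.
  rewrite lerD // ler_wpM2l // mulr_ge0 ?opnorm_ge0 ?sqrtr_ge0 //.
apply: (@le_trans _ _ (Num.sqrt T * (Num.sqrt rho *
    (opnorm Gam * Num.sqrt rho * (Num.sqrt T * Num.sqrt Pe)
    + Num.sqrt T * Num.sqrt Pv)))).
  by rewrite !ler_wpM2l ?sqrtr_ge0.
rewrite !sqrtrM ?mulr_ge0 ?(ltW T_gt0) //.
have hT := sqr_sqrtr (ltW T_gt0); have hr := sqr_sqrtr rho_ge0.
have -> : opnorm Gam * (T * rho) = opnorm Gam * (Num.sqrt T ^+ 2 * Num.sqrt rho ^+ 2).
  by rewrite hT hr.
by rewrite le_eqVlt; apply/orP; left; apply/eqP; ring.
Qed.

Hypotheses (Gam_sym : Gam^T = Gam) (Gam_unit : Gam \in unitmx).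
Local Notation S := (invmx Gam).
Local Notation V t := (dot (x t) (S *m x t)).

Let S_sym : S^T = S. Proof. by rewrite trmx_inv Gam_sym. Qed.

Lemma storage_increment :
  integ w w' (fun s => 2 * dot (x s) (S *m f s)) /\
  V w' - V w = segint w w' (fun s => 2 * dot (x s) (S *m f s)).
Proof.
have H i j := segint_mul ww (f_integ i) (f_integ j) (xE i) (xE j).
have h1 i j : integ w w' (fun s => S i j * (f s i 0 * x s j 0 + f s j 0 * x s i 0)).
  by case: (H i j) => [? [? _]]; apply/integZ/integD.
have h2 i : integ w w' (fun s => \sum_j S i j * (f s i 0 * x s j 0 + f s j 0 * x s i 0)).
  by apply: integ_sum => j; exact: h1.
have E s : \sum_i \sum_j S i j * (f s i 0 * x s j 0 + f s j 0 * x s i 0) =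
    2 * dot (x s) (S *m f s).
  have sym : dot (x s) (S *m f s) = dot (f s) (S *m x s).
    by rewrite -[in LHS]S_sym -dot_mulmx dotC.
  rewrite mulr_natl mulr2n {1}sym !dotE -big_split; apply: eq_bigr => i _ /=.
  rewrite !mxE !mulr_sumr -big_split; apply: eq_bigr => j _ /=; ring.
split; first by apply: (@eq_integ _ _ _ _ _ _ (integ_sum h2)) => s _.
rewrite -(@eq_segint _ _ _ _ _ (fun s _ => E s)) segint_sum //.
have EV t : V t = \sum_i \sum_j S i j * (x t i 0 * x t j 0).
  rewrite dotE; apply: eq_bigr => i _; rewrite mxE mulr_sumr.
  by apply: eq_bigr => j _; ring.
rewrite !EV -sumrB; apply: eq_bigr => i _; rewrite segint_sum // -sumrB.
apply: eq_bigr => j _; case: (H i j) => [hfg [hgf hV]].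
rewrite segintZ; last exact: integD.
by rewrite segintD // -hV; ring.
Qed.

Variables (c X c1 c2 F : R).
Hypotheses (c_gt0 : 0 < c) (c1_gt0 : 0 < c1).
Hypothesis S_le : forall y, enorm (S *m y) <= enorm y / c.
Hypothesis x_le : forall t, w <= t <= w' -> enorm (x t) <= X.
Hypothesis X_ge0 : 0 <= X.
Hypothesis hX : 2 * c1 / c * (X * (Num.sqrt T * Num.sqrt Pv)) <=
  c2 * T * Pxi + c1 * Pe + F * Pv.
Hypothesis d_integ : integ w w' (fun s => enorm (L s *m x s - e s) ^+ 2).

(** [- 2 xi . e = |xi - e|^2 - |xi|^2 - |e|^2], so that [|e|^2] is dissipated with
    the same weight as [|xi|^2]. The former pays for the variation of [x] within
    the window. *)
Lemma dissipation :
  c1 * (V w' - V w) + (c1 - c2 * T) * Pxi <=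
  c1 * segint w w' (fun s => enorm (L s *m x s - e s) ^+ 2) + F * Pv.
Proof.
have [iV ->] := storage_increment.
set Pd := segint w w' (fun s => enorm (L s *m x s - e s) ^+ 2).
have h : segint w w' (fun s => 2 * dot (x s) (S *m f s)) <=
   Pd - Pxi - Pe + 2 * X / c * segint w w' (fun s => enorm (v s)).
  rewrite /Pd -segintZ // -!segintB //; last exact: integB.
  rewrite -segintD //; [|by apply: integB => //; exact: integB|exact: integZ].
  apply: le_segint => //.
    by apply: integD; [apply: integB => //; exact: integB|exact: integZ].
  move=> s hs; rewrite fE // mulmxBr dotDr mulmxN dotNr mulKmx // dotNr.
  rewrite -dot_mulmx enormD_sq dotNr enormN.
  have := norm_dot_le (x s) (S *m v s); rewrite ler_norml => /andP[h1 _].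
  have h2 : enorm (x s) * enorm (S *m v s) <= X * (enorm (v s) / c).
    by apply: ler_pM; rewrite ?enorm_ge0 ?x_le ?S_le.
  have -> : 2 * X / c * enorm (v s) = 2 * (X * (enorm (v s) / c)) by ring.
  lra.
have hv := segint_norm_le nv_integ v_integ.
have h3 : 2 * X / c * segint w w' (fun s => enorm (v s)) <=
   2 * X / c * (Num.sqrt T * Num.sqrt Pv).
  by rewrite ler_wpM2l // divr_ge0 ?mulr_ge0 // ltW.
have h4 : c1 * (2 * X / c * (Num.sqrt T * Num.sqrt Pv)) =
   2 * c1 / c * (X * (Num.sqrt T * Num.sqrt Pv)) by ring.
have h5 : c1 * segint w w' (fun s => 2 * dot (x s) (S *m f s)) <=
   c1 * (Pd - Pxi - Pe + 2 * X / c * (Num.sqrt T * Num.sqrt Pv)).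
  by rewrite ler_pM2l //; apply: le_trans h _; rewrite lerD2l.
move: h5 hX; rewrite mulrDr h4; clear h h3 h4.
set Z := 2 * c1 / c * (X * (Num.sqrt T * Num.sqrt Pv)).
set J := segint w w' (fun s => 2 * dot (x s) (S *m f s)).
by clearbody Z J Pd; lra.
Qed.

End Window.

(** * From windows to the half line *)

Section HalfLine.
Context {R : realType}.
Local Notation mu := (@lebesgue_measure R).
Local Notation D0 := [set` `[(0:R), +oo[].
Local Notation mfun f := (measurable_fun D0 f).

Lemma meas_enorm m (x : R -> 'cV[R]_m) : measurable_mx x ->
  mfun (fun t => enorm (x t)).
Proof.
move=> mx; apply: (@eq_meas _ (fun t => Num.sqrt (dot (x t) (x t)))) => [t|].
  exact: enormE.
apply: (@measurableT_comp _ _ _ _ _ _ (@Num.sqrt R)); last exact: meas_dot.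
by apply: continuous_measurable_fun => y; exact: sqrt_continuous.
Qed.

Lemma meas_sqr (f : R -> R) : mfun f -> mfun (fun t => f t ^+ 2).
Proof.
by move=> mf; apply: measurable_funM.
Qed.

Lemma half_line_cover (T : R) : 0 < T ->
  D0 = \bigcup_(m : nat) [set` `[0, m%:R * T]].
Proof.
move=> T0; apply/seteqP; split=> [t|t [m _ /=]]; rewrite /= !in_itv /= ?andbT.
  move=> t0; exists (Num.bound (t / T)) => //=; rewrite in_itv /= t0 /=.
  by rewrite -ler_pdivrMr // ltW // archi_boundP // divr_ge0 // ltW.
by case/andP.
Qed.

Lemma meas_half_line (f : R -> R) :
  (forall b : R, 0 <= b -> measurable_fun [set` `[0, b]] f) -> mfun f.
Proof.
move=> mf; rewrite (half_line_cover ltr01).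
apply/measurable_fun_bigcup => m; first exact: measurable_itv.
by apply: mf; rewrite mulr1.
Qed.

Lemma meas_seg (a b : R) (f : R -> R) : 0 <= a -> mfun f ->
  measurable_fun [set` `[a, b]] f.
Proof.
move=> a0; apply: measurable_funS; first exact: measurable_itv.
by move=> t; rewrite /= !in_itv /= => /andP[/(le_trans a0) -> _].
Qed.

(** Monotone convergence along the multiples of [T]. *)
Lemma half_line_integral_le (f : R -> R) T B : 0 < T -> mfun f ->
  (forall t, 0 <= t -> 0 <= f t) ->
  (forall m : nat, integ 0 (m%:R * T) f) ->
  (forall m : nat, segint 0 (m%:R * T) f <= B) ->
  (\int[mu]_(s in `[0%R, +oo[) (f s)%:E <= B%:E)%E.
Proof.
move=> T0 mf f0 hf hB.
rewrite (half_line_cover T0).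
pose F (m : nat) : set R := [set` `[0, m%:R * T]].
have nd : nondecreasing_seq F.
  move=> i j ij; apply/subsetPset => t; rewrite /F /= !in_itv /= => /andP[-> /=].
  by move/le_trans; apply; rewrite ler_pM2r // ler_nat.
have mF i : measurable (F i) by exact: measurable_itv.
have h : (\int[mu]_(s in F m) (f s)%:E)%E @[m --> \oo] -->
    (\int[mu]_(s in \bigcup_m F m) (f s)%:E)%E.
  apply: ge0_nondecreasing_set_cvg_integral => //.
    by move=> i; apply/measurable_EFinP; exact: meas_seg.
  by move=> i t; rewrite /F /= in_itv /= => /andP[t0 _]; rewrite lee_fin f0.
apply: cvge_le h; apply: nearW => m.
have -> : (\int[mu]_(s in F m) (f s)%:E)%E = (segint 0 (m%:R * T) f)%:E.
  by rewrite /segint /Rintegral fineK //; apply: (integrable_fin_num _ (hf m)).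
by rewrite lee_fin.
Qed.

Lemma primitive_meas (f x : R -> R) x0 :
  (forall b, 0 <= b -> integ 0 b f) ->
  (forall t, 0 <= t -> x t = x0 + segint 0 t f) -> mfun x.
Proof.
move=> hf hx; apply: meas_half_line => b b0.
apply: (@eq_measurable_fun _ _ _ _ _ (fun t => x0 + segint 0 t f)).
  by move=> t; rewrite inE /= in_itv /= => /andP[t0 _]; rewrite hx.
apply: measurable_funD => //.
by apply: subspace_continuous_measurable_fun => //; apply: segint_continuous => //; exact: hf.
Qed.

End HalfLine.

(** * The error system *)

Section ErrorSystem.
Context {R : realType}.
Local Notation mu := (@lebesgue_measure R).
Local Notation D0 := [set` `[(0:R), +oo[].
Local Notation mfun f := (measurable_fun D0 f).
Variables (n N Ny p r : nat) (n_gt0 : (0 < n)%N).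
Variables (G : R -> rel 'I_n) (ne : R -> nat) (D : forall t : R, 'M[R]_(n, ne t)).
Variable C : 'I_n -> R -> 'M[R]_(Ny, N).
Hypothesis D_inc : forall t : R, 0 <= t -> oriented_incidence (G t) (D t).
Hypotheses (D_meas : measurable_mxdep D) (C_meas : forall i, measurable_mx (C i)).
Variables (Gam : 'M[R]_(n * N)) (D1 : 'M[R]_(n * N, r)).
Variable D2 : forall m : nat, 'M[R]_(n * Ny + m * N, r).
Variables (Q : forall m : nat, 'M[R]_(p, n * Ny + m * N)) (W : 'M[R]_(p, r)).
Hypotheses (WW : W^T *m W = 1%:M).
Hypothesis QW : forall t : R, 0 <= t -> (Q (ne t))^T *m W = 0.
Variables T i1up i1lo r2 r3 lam : R.
Hypotheses (T_gt0 : 0 < T) (i1lo_gt0 : 0 < i1lo).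
Hypotheses (r2_gt0 : 0 < r2) (r3_gt0 : 0 < r3) (lam_gt0 : 0 < lam).
Hypotheses (Hi : cond_i C T i1up i1lo) (Hii : cond_ii C r2).
Hypothesis Hiii : cond_iii D T lam r3.
Variables alpha c2 c1 g1 g2 g : R.
Local Notation r1 := (opnorm Gam).
Local Notation i3up := (iota3_up n N T r1 r2 r3 i1lo lam alpha).
Local Notation i3lo := (iota3_lo n N T r1 r2 r3 i1lo lam alpha).
Local Notation rho := (r4 r2 r3 alpha).
Local Notation L t := (Lambda alpha (C^~ t) (D t)).
Hypotheses (alpha_gt0 : 0 < alpha) (c2_gt0 : 0 < c2).
Hypothesis feas : sdp_feasible ne T c2 i3up i3lo rho D1 D2 Q W c1 g1 g2 g.
Hypothesis Gam_sym : Gam^T = Gam.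
Hypothesis Gam_lo : lemx (Num.sqrt g2)%:M Gam.

Let c1_gt0 : 0 < c1. Proof. by case: feas => -[]. Qed.
Let g1_gt0 : 0 < g1. Proof. by case: feas => -[]. Qed.
Let g2_gt0 : 0 < g2. Proof. by case: feas => -[]. Qed.
Let g_gt0 : 0 < g. Proof. by case: feas. Qed.
Let c_gt0 : 0 < Num.sqrt g2. Proof. by rewrite sqrtr_gt0. Qed.
Let rho_gt0 : 0 < rho. Proof. by rewrite /r4 addr_gt0 // mulr_gt0. Qed.
Let up_gt0 : 0 < iota2_up T r2 r3 alpha. Proof. by rewrite mulr_gt0. Qed.
Let i3lo_ge0 : 0 <= i3lo. Proof. exact/iota3_lo_ge0/ltW. Qed.

Let L_le t y : 0 <= t -> enorm (L t *m y) ^+ 2 <= rho * enorm y ^+ 2.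
Proof.
move=> t0; apply: enorm_Lambda_le; [exact: ltW | by move=> i; exact: Hii |].
by case: Hiii => _; exact.
Qed.

Let output_le t xi : 0 <= t ->
  enorm (Q (ne t) *m xi) ^+ 2 <= (c1 - c2 * T) * enorm xi ^+ 2.
Proof.
by move=> t0; case: feas => _ _ _ /(_ t t0) h; exact: (lmi_output h).
Qed.

Let F := 4 * c1 ^+ 2 / (c2 * i3lo * g2).

Let F_ge0 : 0 <= F.
Proof. by rewrite /F divr_ge0 ?mulr_ge0 ?sqr_ge0 // ltW. Qed.

Let input_le t d : 0 <= t ->
  c1 * enorm (D2 (ne t) *m d) ^+ 2 + F * enorm (D1 *m d) ^+ 2 + enorm d ^+ 2
  <= g * enorm d ^+ 2.
Proof.
move=> t0; case: feas => _ _ _ /(_ t t0) h.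
exact: (lmi_input c2_gt0 i3lo_ge0 g2_gt0 g1_gt0 (ltW rho_gt0) WW h).
Qed.

Let seg w : 0 <= w -> forall s, w <= s <= w + T -> 0 <= s.
Proof. by move=> w0 s /andP[/(le_trans w0)]. Qed.

Let gram_integ w k i j : 0 <= w ->
  integ w (w + T) (fun s => ((C k s)^T *m C k s) i j).
Proof.
move=> w0; apply: (@le_integ _ _ _ _ (fun=> r2)); last exact: integ_cst.
  by apply: meas_seg => //; apply: meas_mul => //; exact: meas_tr.
move=> s hs; apply: le_trans (opnorm_entry _ _ _) _.
by apply: Hii; exact: seg hs.
Qed.

Let lap_integ w i j : 0 <= w ->
  integ w (w + T) (fun s => laplacian (D s) i j).
Proof.
move=> w0; apply: (@le_integ _ _ _ _ (fun=> r3)); last exact: integ_cst.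
  apply: meas_seg => //.
  apply: (@meas_dep _ _ _ _ (fun m t (A : 'M[R]_(n, m)) => laplacian A i j)) => //.
  by move=> m A mA; apply: meas_mul => //; exact: meas_tr.
move=> s hs; apply: le_trans (opnorm_entry _ _ _) _.
by case: Hiii => _; apply; exact: seg hs.
Qed.

Let PE w y : 0 <= w -> iota2_lo n N T r2 i1lo lam alpha * enorm y ^+ 2 <=
  segint w (w + T) (fun s => enorm (L s *m y) ^+ 2).
Proof.
move=> w0; have wT : T <= w + T by rewrite lerDr.
have wE : w + T - T = w by rewrite addrK.
have [_ glo] := Hi wT; have [lgap _] := Hiii; have := lgap _ wT.
rewrite wE in glo * => lg.
apply: (@excitation R n N n_gt0 T r2 i1lo lam alpha
  T_gt0 r2_gt0 lam_gt0 alpha_gt0 Ny C ne D G w) => //.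
- by move=> s i hs; apply: Hii; exact: seg hs.
- by move=> s hs; apply: D_inc; exact: seg hs.
- by move=> k i j; exact: gram_integ.
- by move=> i j; exact: lap_integ.
Qed.

Let PE_integ w y : 0 <= w -> integ w (w + T) (fun s => enorm (L s *m y) ^+ 2).
Proof.
move=> w0; apply: Lambda_integ => //.
- by move=> k i j; exact: gram_integ.
- by move=> i j; exact: lap_integ.
Qed.

(** Without a nonzero state on which to test the excitation, both comparisons
    can fail: when [n * N = 0], nothing relates [iota2_lo] to [iota2_up]. *)
Let nontrivial_bounds : (0 < n * N)%N ->
  iota2_lo n N T r2 i1lo lam alpha <= iota2_up T r2 r3 alpha /\ c2 * T <= c1.
Proof.
move=> k0; pose y : 'cV[R]_(n * N) := const_mx 1.
have y0 : 0 < enorm y ^+ 2.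
  rewrite exprn_gt0 // lt_neqAle eq_sym enorm_eq0 enorm_ge0 andbT; apply/eqP.
  by move/matrixP/(_ (Ordinal k0) 0); rewrite !mxE => /eqP; rewrite oner_eq0.
have h := PE y (lexx 0).
have a0 : 0 < iota2_lo n N T r2 i1lo lam alpha by exact: iota2_lo_gt0.
have T0 : 0 <= 0 + T :> R by rewrite add0r ltW.
split.
  rewrite -(ler_pM2r y0); apply: (le_trans h).
  apply: (@le_trans _ _ (segint 0 (0 + T) (fun=> rho * enorm y ^+ 2))).
    apply: le_segint; [exact: PE_integ|exact: integ_cst|].
    by move=> s /andP[s0 _]; exact: L_le.
  by rewrite segint_cst // add0r subr0 /iota2_up le_eqVlt; apply/orP; left; apply/eqP; ring.
rewrite leNgt; apply/negP => cT.
suff : iota2_lo n N T r2 i1lo lam alpha * enorm y ^+ 2 <= 0.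
  by apply/negP; rewrite -ltNge mulr_gt0.
apply: (le_trans h); rewrite (@eq_segint _ _ _ _ (fun=> 0)) ?segint_cst ?mul0r // => s /andP[s0 _].
have := output_le (L s *m y) s0; have := sqr_ge0 (enorm (Q (ne s) *m (L s *m y))).
have := sqr_ge0 (enorm (L s *m y)).
move: (enorm (L s *m y) ^+ 2) (enorm _ ^+ 2) => A B A0 B0 hAB.
by apply/eqP; rewrite eq_le A0 andbT; nra.
Qed.

Variables (u : R -> 'cV[R]_r) (x0 : 'cV[R]_(n * N)) (x : R -> 'cV[R]_(n * N)).
Hypothesis u_L2 : is_L2 u.
Hypothesis x_sol : ode_solution (fun t xi =>
   - (Gam *m (L t)^T *m L t *m xi) + (Gam *m (L t)^T *m D2 (ne t) - D1) *m u t) x0 x.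

Let xi t := L t *m x t.
Let e t := xi t - D2 (ne t) *m u t.
Let v t := D1 *m u t.
Let f t := - (Gam *m (L t)^T *m L t *m x t) + (Gam *m (L t)^T *m D2 (ne t) - D1) *m u t.
Let z t := Q (ne t) *m L t *m x t + W *m u t.

Let f_integ i b : 0 <= b -> integ 0 b (fun s => f s i 0).
Proof. by move=> b0; have [h _] := x_sol b0; exact: h. Qed.

Let x_int i t : 0 <= t -> x t i 0 = x0 i 0 + segint 0 t (fun s => f s i 0).
Proof. by move=> t0; have [_ ->] := x_sol t0; rewrite mxE [X in _ + X]mxE. Qed.

Let f_E t : f t = - (Gam *m ((L t)^T *m e t)) - v t.
Proof.
rewrite /f /e /xi /v mulmxBl !mulmxBr !mulmxA opprB addrA; congr (_ - _).
by rewrite addrC.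
Qed.

Let x_meas : measurable_mx x.
Proof.
move=> i j; rewrite ord1; apply: (@primitive_meas _ (fun s => f s i 0) _ (x0 i 0)).
  by move=> b; exact: f_integ.
by move=> t; exact: x_int.
Qed.

Let u_meas : measurable_mx u. Proof. by case: u_L2. Qed.

Let xi_meas : mfun (fun t => enorm (xi t)).
Proof.
apply: (@meas_dep _ _ _ _ (fun m t (A : 'M[R]_(n, m)) =>
  enorm (Lambda alpha (C^~ t) A *m x t))) => // m A mA.
by apply: meas_enorm; apply: meas_mul x_meas; exact: meas_Lambda C_meas mA.
Qed.

Let e_meas : mfun (fun t => enorm (e t)).
Proof.
apply: (@meas_dep _ _ _ _ (fun m t (A : 'M[R]_(n, m)) =>
  enorm (Lambda alpha (C^~ t) A *m x t - D2 m *m u t))) => // m A mA.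
apply: meas_enorm; apply: meas_add.
  by apply: meas_mul x_meas; exact: meas_Lambda C_meas mA.
by apply: meas_opp; apply: meas_mul u_meas; exact: meas_cst.
Qed.

Let d_meas : mfun (fun t => enorm (D2 (ne t) *m u t)).
Proof.
apply: (@meas_dep _ _ _ D (fun m t (A : 'M[R]_(n, m)) =>
  enorm (D2 m *m u t))) => // m A mA.
by apply: meas_enorm; apply: meas_mul u_meas; exact: meas_cst.
Qed.

Let v_meas : mfun (fun t => enorm (v t)).
Proof. by apply: meas_enorm; apply: meas_mul u_meas; exact: meas_cst. Qed.

Lemma z_meas : measurable_mx z.
Proof.
move=> i j; apply: (@meas_dep _ _ _ _ (fun m t (A : 'M[R]_(n, m)) =>
  (Q m *m Lambda alpha (C^~ t) A *m x t + W *m u t) i j)) => // m A mA.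
apply: meas_add; last by apply: meas_mul u_meas; exact: meas_cst.
apply: meas_mul x_meas; apply: meas_mul; first exact: meas_cst.
exact: meas_Lambda C_meas mA.
Qed.

Let energyE k (y : R -> 'cV[R]_k) :
  energy y = (\int[mu]_(s in `[0%R, +oo[) (enorm (y s) ^+ 2)%:E)%E.
Proof. by apply: eq_integral => s _; rewrite enorm_sq. Qed.

Let u_integ0 : mu.-integrable D0 (EFin \o (fun s => enorm (u s) ^+ 2)).
Proof.
apply/integrableP; split.
  by apply/measurable_EFinP; exact: meas_sqr (meas_enorm u_meas).
case: u_L2 => _; rewrite energyE; apply: le_lt_trans.
rewrite le_eqVlt; apply/orP; left; apply/eqP; apply: eq_integral => s _ /=.
by rewrite ger0_norm // sqr_ge0.
Qed.

Let u_integ b : 0 <= b -> integ 0 b (fun s => enorm (u s) ^+ 2).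
Proof.
move=> b0; apply: integrableS u_integ0 => //.
by move=> s; rewrite /= !in_itv /= => /andP[->].
Qed.

Let segint_u_le b : 0 <= b -> segint 0 b (fun s => enorm (u s) ^+ 2) <= fine (energy u).
Proof.
move=> b0; rewrite energyE /segint /Rintegral fine_le //.
- exact: integrable_fin_num (u_integ b0).
- exact: integrable_fin_num u_integ0.
apply: ge0_subset_integral => //.
- by apply/measurable_EFinP; exact: meas_sqr (meas_enorm u_meas).
- by move=> s _; rewrite lee_fin sqr_ge0.
- by move=> s; rewrite /= !in_itv /= => /andP[->].
Qed.

Let d_integ b : 0 <= b -> integ 0 b (fun s => enorm (D2 (ne s) *m u s) ^+ 2).
Proof.
move=> b0; apply: (@le_integ _ _ _ _ (fun s => g / c1 * enorm (u s) ^+ 2)).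
- by apply: meas_seg => //; exact: meas_sqr.
- move=> s /andP[s0 _]; rewrite ger0_norm ?sqr_ge0 // mulrAC ler_pdivlMr // mulrC.
  apply: le_trans (input_le (u s) s0); rewrite -addrA lerDl.
  by apply: addr_ge0; [apply: mulr_ge0 F_ge0 _; exact: sqr_ge0|exact: sqr_ge0].
- exact/integZ/u_integ.
Qed.

Let v_integ b : 0 <= b -> integ 0 b (fun s => enorm (v s) ^+ 2).
Proof.
move=> b0; apply: (@le_integ _ _ _ _ (fun s => opnorm D1 ^+ 2 * enorm (u s) ^+ 2)).
- by apply: meas_seg => //; exact: meas_sqr.
- move=> s _; rewrite ger0_norm ?sqr_ge0 // -exprMn.
  rewrite lerXn2r ?nnegrE ?mulr_ge0 ?enorm_ge0 ?opnorm_ge0 //.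
  exact: enorm_mulmx_le.
- exact/integZ/u_integ.
Qed.

Let xi_integ b : 0 <= b -> integ 0 b (fun s => enorm (xi s) ^+ 2).
Proof.
move=> b0; pose B i := `|x0 i 0| + segint 0 b (fun s => `|f s i 0|).
apply: (@le_integ _ _ _ _ (fun s => rho * \sum_i B i ^+ 2)); last exact: integ_cst.
  by apply: meas_seg => //; exact: meas_sqr.
move=> s /andP[s0 sb]; rewrite ger0_norm ?sqr_ge0 //.
apply: le_trans (L_le _ s0) _; rewrite ler_wpM2l ?(ltW rho_gt0) //.
rewrite enorm_sq dotE; apply: ler_sum => i _.
rewrite -expr2 -[x s i 0 ^+ 2]real_normK ?num_real //.
have h : `|x s i 0| <= B i.
  rewrite x_int //; apply: le_trans (ler_normD _ _) _; rewrite lerD2l.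
  by apply: norm_segint_le; [exact: f_integ|rewrite s0].
by rewrite lerXn2r ?nnegrE ?normr_ge0 // (le_trans _ h).
Qed.

Let e_integ b : 0 <= b -> integ 0 b (fun s => enorm (e s) ^+ 2).
Proof.
move=> b0; apply: (@le_integ _ _ _ _ (fun s => 2 * enorm (xi s) ^+ 2 +
  2 * enorm (D2 (ne s) *m u s) ^+ 2)).
- by apply: meas_seg => //; exact: meas_sqr.
- move=> s _; rewrite ger0_norm ?sqr_ge0 // /e.
  have := sqr_ge0 (enorm (xi s + D2 (ne s) *m u s)).
  rewrite !enormD_sq dotNr enormN; lra.
- by apply: integD; apply: integZ; [exact: xi_integ|exact: d_integ].
Qed.

Let z_sq t : 0 <= t ->
  enorm (z t) ^+ 2 = enorm (Q (ne t) *m xi t) ^+ 2 + enorm (u t) ^+ 2.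
Proof.
move=> t0; rewrite /z -mulmxA -/(xi t) enormD_sq.
have -> : dot (Q (ne t) *m xi t) (W *m u t) = 0.
  by rewrite dot_mulmx mulmxA QW // mul0mx dot0r.
have -> : enorm (W *m u t) ^+ 2 = enorm (u t) ^+ 2.
  by rewrite !enorm_sq dot_mulmx mulmxA WW mul1mx.
by rewrite mulr0 addr0.
Qed.

Let z_le t : 0 <= t -> enorm (z t) ^+ 2 <=
  (c1 - c2 * T) * enorm (xi t) ^+ 2 + enorm (u t) ^+ 2.
Proof. by move=> t0; rewrite z_sq // lerD2r; exact: output_le. Qed.

Let z_meas_sqr : mfun (fun t => enorm (z t) ^+ 2).
Proof. exact: meas_sqr (meas_enorm z_meas). Qed.

Let z_integ b : 0 <= b -> integ 0 b (fun s => enorm (z s) ^+ 2).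
Proof.
move=> b0; apply: (@le_integ _ _ _ _ (fun s =>
    (c1 - c2 * T) * enorm (xi s) ^+ 2 + enorm (u s) ^+ 2)).
- exact: meas_seg.
- by move=> s /andP[s0 _]; rewrite ger0_norm ?sqr_ge0 // z_le.
- by apply: integD; [exact/integZ/xi_integ|exact: u_integ].
Qed.

Local Notation V t := (dot (x t) (invmx Gam *m x t)).
Local Notation sq y := (fun s => enorm (y s) ^+ 2).

Let integ_window w (h : R -> R) : 0 <= w -> (forall b, 0 <= b -> integ 0 b h) ->
  integ w (w + T) h.
Proof.
by move=> w0 hh; apply: integS (hh (w + T) _); rewrite ?addr_ge0 // ltW.
Qed.

Let norm_integ (y : R -> R) w : 0 <= w -> mfun y ->
  (forall b, 0 <= b -> integ 0 b (fun s => y s ^+ 2)) -> integ w (w + T) y.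
Proof.
by move=> w0 my hy; apply: integ_of_sqr; [exact: meas_seg|exact: integ_window].
Qed.

(** When [n * N = 0] the state is zero and the bound is [X = 0]. *)
Let window_gain w : 0 <= w ->
  exists2 X, 0 <= X /\ (forall t, w <= t <= w + T -> enorm (x t) <= X) &
  2 * c1 / Num.sqrt g2 * (X * (Num.sqrt T * Num.sqrt (segint w (w + T) (sq v)))) <=
  c2 * T * segint w (w + T) (sq xi) + c1 * segint w (w + T) (sq e) + F * segint w (w + T) (sq v).
Proof.
move=> w0.
have P0 (y : R -> R) : 0 <= segint w (w + T) (fun s => y s ^+ 2).
  by apply: segint_ge0 => s _; exact: sqr_ge0.
have [k0|k0] := posnP (n * N).
  exists 0; last first.
    rewrite mul0r mulr0; apply: addr_ge0; last exact: mulr_ge0 F_ge0 (P0 _).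
    by apply: addr_ge0; rewrite mulr_ge0 ?P0 ?mulr_ge0 // ltW.
  split=> // t _; rewrite enormE dotE big1 ?sqrtr0 // => i _.
  by have := ltn_ord i; rewrite {2}k0.
have [ab cT] := nontrivial_bounds k0.
have a0 : 0 < iota2_lo n N T r2 i1lo lam alpha by exact: iota2_lo_gt0.
have sa0 : 0 < Num.sqrt (iota2_lo n N T r2 i1lo lam alpha) by rewrite sqrtr_gt0.
have [i30 hi3] := iota3_lo_bounds r1 a0 ab.
pose B := Num.sqrt (segint w (w + T) (sq xi)) + r1 * (T * rho) * Num.sqrt (segint w (w + T) (sq e))
   + Num.sqrt (T * rho * T) * Num.sqrt (segint w (w + T) (sq v)).
have B0 : 0 <= B.
  by rewrite !addr_ge0 ?mulr_ge0 ?sqrtr_ge0 ?opnorm_ge0 // ltW.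
exists (B / Num.sqrt (iota2_lo n N T r2 i1lo lam alpha)).
  split; first by rewrite divr_ge0 // ltW.
  move=> t ht; rewrite ler_pdivlMr // mulrC.
  apply: (@x_bound _ _ _ Gam (fun t => L t) e v x f w T) => //.
  - exact: ltW.
  - by move=> i; apply: integ_window => // b; exact: f_integ.
  - move=> i t' /andP[wt tw]; have t0 := le_trans w0 wt.
    rewrite (x_int i t0) (x_int i w0) -addrA; congr (_ + _).
    exact: segint_split (f_integ i t0) w0 wt.
  - by move=> t' y ht'; apply: L_le; exact: seg ht'.
  - exact: norm_integ.
  - exact: norm_integ.
  - exact: norm_integ.
  - exact: integ_window.
  - exact: integ_window.
  - exact: integ_window.
  - by move=> y; exact: PE_integ.
  - by move=> y; exact: PE.
have := @window_algebra _ (iota2_lo n N T r2 i1lo lam alpha) (iota2_up T r2 r3 alpha)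
  i3lo r1 T c1 c2 g2 (Num.sqrt (segint w (w + T) (sq xi))) (Num.sqrt (segint w (w + T) (sq e)))
  (Num.sqrt (segint w (w + T) (sq v))) (B / Num.sqrt (iota2_lo n N T r2 i1lo lam alpha)).
rewrite !(sqr_sqrtr (P0 _)); apply => //; rewrite ?sqrtr_ge0 //.
  exact: gain_le_opnorm Gam_lo k0.
by rewrite mulrC divfK ?lt0r_neq0 // /B /iota2_up [T * rho * T]mulrC.
Qed.

Lemma window_dissipation w : 0 <= w ->
  c1 * (V (w + T) - V w) + segint w (w + T) (sq z) <= g * segint w (w + T) (sq u).
Proof.
move=> w0; have [X [X0 xX] hX] := window_gain w0.
have iu := integ_window w0 u_integ; have iz := integ_window w0 z_integ.
have ixi := integ_window w0 xi_integ; have ie := integ_window w0 e_integ.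
have iv := integ_window w0 v_integ; have id := integ_window w0 d_integ.
have dE s : L s *m x s - e s = D2 (ne s) *m u s.
  by rewrite /e /xi opprB addrC subrK.
have h : c1 * (V (w + T) - V w) + (c1 - c2 * T) * segint w (w + T) (sq xi) <=
    c1 * segint w (w + T) (fun s => enorm (D2 (ne s) *m u s) ^+ 2) + F * segint w (w + T) (sq v).
  rewrite -(@eq_segint _ _ _ _ _ (fun s _ => congr1 (fun y => enorm y ^+ 2) (dE s))).
  apply: (@dissipation R (n * N) _ Gam (fun t => L t) e v x f w T T_gt0 _ _ _ _ _ _ _
     Gam_sym (gain_unit c_gt0 Gam_sym Gam_lo) (Num.sqrt g2) X c1 c2 F c_gt0 c1_gt0
     _ xX X0 hX _) => //.
  - by move=> i; apply: integ_window => // b; exact: f_integ.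
  - move=> i t /andP[wt tw]; have t0 := le_trans w0 wt.
    rewrite (x_int i t0) (x_int i w0) -addrA; congr (_ + _).
    exact: segint_split (f_integ i t0) w0 wt.
  - exact: norm_integ.
  - by move=> y; exact: gain_inv_le.
  - by apply: eq_integ id => s _; rewrite dE.
have hz : segint w (w + T) (sq z) <=
    (c1 - c2 * T) * segint w (w + T) (sq xi) + segint w (w + T) (sq u).
  rewrite -segintZ // -segintD //; last exact: integZ.
  apply: le_segint => //; first by apply: integD => //; exact: integZ.
  by move=> s hs; apply: z_le; exact: seg hs.
have hg : c1 * segint w (w + T) (fun s => enorm (D2 (ne s) *m u s) ^+ 2)
    + F * segint w (w + T) (sq v) + segint w (w + T) (sq u) <= g * segint w (w + T) (sq u).
  have i1 := integZ c1 id; have i2 := integZ F iv; have i3 := integZ g iu.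
  have i12 := integD i1 i2; have i123 := integD i12 iu.
  rewrite -(segintZ _ id) -(segintZ _ iv) -(segintZ _ iu) -(segintD i1 i2) -(segintD i12 iu).
  by apply: le_segint => // s hs; apply: input_le; exact: seg hs.
lra.
Qed.

Lemma horizon_dissipation (m : nat) :
  c1 * V (m%:R * T) + segint 0 (m%:R * T) (sq z) <=
  c1 * V 0 + g * segint 0 (m%:R * T) (sq u).
Proof.
elim: m => [|m IHm]; first by rewrite mul0r !segint_point mulr0.
have mT : 0 <= m%:R * T by rewrite mulr_ge0 // ltW.
have := window_dissipation mT.
have mE : m.+1%:R * T = m%:R * T + T by rewrite -natr1 mulrDl mul1r.
have mm : m%:R * T <= m.+1%:R * T by rewrite mE lerDl ltW.
have mT1 := le_trans mT mm.
rewrite -mE (segint_split (z_integ mT1) mT mm) (segint_split (u_integ mT1) mT mm).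
lra.
Qed.

(** The storage function at the end of the horizon is dropped by sign. *)
Lemma energy_z_le : (energy z <= (c1 * V 0 + g * fine (energy u))%:E)%E.
Proof.
rewrite energyE; apply: (half_line_integral_le T_gt0 z_meas_sqr).
- by move=> t _; exact: sqr_ge0.
- by move=> m; apply: z_integ; rewrite mulr_ge0 // ltW.
move=> m; have mT : 0 <= m%:R * T by rewrite mulr_ge0 // ltW.
have h := horizon_dissipation m.
have V0 : 0 <= c1 * V (m%:R * T).
  by rewrite mulr_ge0 ?(ltW c1_gt0) // (gain_inv_ge0 c_gt0 Gam_sym Gam_lo).
have hu : g * segint 0 (m%:R * T) (sq u) <= g * fine (energy u).
  by rewrite ler_wpM2l ?(ltW g_gt0) // segint_u_le.
lra.
Qed.

Lemma L2norm_z_le : is_L2 z /\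
  L2norm z <= Num.sqrt g * L2norm u + Num.sqrt (c1 * V 0).
Proof.
have h := energy_z_le.
have Ez0 : (0 <= energy z)%E.
  by rewrite energyE; apply: integral_ge0 => s _; rewrite lee_fin sqr_ge0.
have V0 : 0 <= c1 * V 0.
  by rewrite mulr_ge0 ?(ltW c1_gt0) // (gain_inv_ge0 c_gt0 Gam_sym Gam_lo).
have Eu0 : 0 <= fine (energy u).
  by apply: le_trans (segint_u_le (lexx 0)); rewrite segint_point.
have Ezy : (energy z < +oo)%E by apply: le_lt_trans h _; exact: ltry.
split; first by split; [exact: z_meas|].
rewrite /L2norm -sqrtrM ?(ltW g_gt0) //.
have h2 : fine (energy z) <= c1 * V 0 + g * fine (energy u).
  by rewrite -lee_fin fineK // ge0_fin_numE.
have gE0 : 0 <= g * fine (energy u) by rewrite mulr_ge0 // ltW.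
apply: (@le_trans _ _ (Num.sqrt (c1 * V 0 + g * fine (energy u)))).
  exact: ler_wsqrtr.
rewrite -(@ler_pXn2r _ 2) // ?nnegrE ?addr_ge0 ?sqrtr_ge0 //.
rewrite (sqr_sqrtr (addr_ge0 V0 gE0)) sqrrD (sqr_sqrtr V0) (sqr_sqrtr gE0).
rewrite addrAC [X in X + _ *+ 2]addrC lerDl mulrn_wge0 //.
Qed.

Lemma x_at0 : x 0 = x0.
Proof. by apply/colP => i; rewrite x_int // segint_point addr0. Qed.

End ErrorSystem.

Lemma eq_L2 (R : realType) k (y z : R -> 'cV[R]_k) :
  (forall t, 0 <= t -> y t = z t) -> is_L2 z ->
  is_L2 y /\ L2norm y = L2norm z.
Proof.
move=> yz; have E : energy y = energy z.
  apply: eq_integral => s; rewrite inE /= in_itv /= andbT => s0.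
  by rewrite yz.
rewrite /is_L2 /L2norm E => -[mz ez]; split=> //; split=> // i j.
apply: eq_measurable_fun (mz i j) => t.
by rewrite inE /= in_itv /= andbT => t0; rewrite yz.
Qed.

Theorem corollary4 (R : realType) (n N Ny p r : nat) (n_gt0 : (0 < n)%N)
  (* communication graph and regressors *)
  (G : R -> rel 'I_n) (ne : R -> nat) (D : forall t : R, 'M[R]_(n, ne t))
  (C : 'I_n -> R -> 'M[R]_(Ny, N))
  (D_incidence : forall t : R, 0 <= t -> oriented_incidence (G t) (D t))
  (D_meas : measurable_mxdep D) (C_meas : forall i, measurable_mx (C i))
  (* gain, disturbance and performance matrices *)
  (Gam : 'I_n -> 'M[R]_N) (Gam_sym : forall i, (Gam i)^T = Gam i)
  (Delta1 : 'M[R]_(N, r)) (Delta2 : forall m : nat, 'M[R]_(n * Ny + m * N, r))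
  (Q : forall m : nat, 'M[R]_(p, n * Ny + m * N)) (W : 'M[R]_(p, r))
  (WW : W^T *m W = 1%:M) (QW : forall t : R, 0 <= t -> (Q (ne t))^T *m W = 0)
  (* conditions (i), (ii), (iii) *)
  (T i1up i1lo r2 r3 lam : R)
  (T_gt0 : 0 < T) (i1lo_gt0 : 0 < i1lo) (i1_le : i1lo <= i1up)
  (r2_gt0 : 0 < r2) (r3_gt0 : 0 < r3) (lam_gt0 : 0 < lam)
  (Hi : cond_i C T i1up i1lo) (Hii : cond_ii C r2) (Hiii : cond_iii D T lam r3)
  (* choice of alpha, feasible point of the program, bounds on the gain *)
  (alpha c2 c1 g1 g2 g : R) :
  let Gbar := blkdiag Gam in
  let D1bar := stack1 n Delta1 in
  let r1 := opnorm Gbar in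
  let i3up := iota3_up n N T r1 r2 r3 i1lo lam in
  let i3lo := iota3_lo n N T r1 r2 r3 i1lo lam in
  let L (t : R) := Lambda alpha (C^~ t) (D t) in
  is_argmax_pos (fun a => i3lo a / i3up a) alpha ->
  0 < c2 ->
  sdp_feasible ne T c2 (i3up alpha) (i3lo alpha) (r4 r2 r3 alpha)
    D1bar Delta2 Q W c1 g1 g2 g ->
  lemx Gbar (Num.sqrt g1)%:M -> lemx (Num.sqrt g2)%:M Gbar ->
  forall (x0 : 'cV[R]_(n * N)) (H : (R -> 'cV[R]_r) -> R -> 'cV[R]_p),
  is_io_map
    (fun t x d => - (Gbar *m (L t)^T *m L t *m x)
                  + (Gbar *m (L t)^T *m Delta2 (ne t) - D1bar) *m d)
    (fun t x d => Q (ne t) *m L t *m x + W *m d) x0 H ->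
  (L2gain H <= (Num.sqrt g)%:E)%E.
Proof.
move=> Gbar D1bar r1 i3up i3lo L [alpha_gt0 _] c2_gt0 feas _ Glo x0 H HH.
have Gsym : Gbar^T = Gbar.
  have [h _] := Glo; move: h; rewrite linearB /= tr_scalar_mx.
  by move/addIr.
apply: ereal_inf_lbound; exists (Num.sqrt g) => //=; split; first exact: sqrtr_ge0.
exists (Num.sqrt (c1 * dot x0 (invmx Gbar *m x0))); split; first exact: sqrtr_ge0.
move=> u uL2; have [x [xsol hz]] := HH u uL2.
have [zL2 zle] := L2norm_z_le n_gt0 D_incidence D_meas C_meas WW QW T_gt0 i1lo_gt0
  r2_gt0 r3_gt0 lam_gt0 Hi Hii Hiii alpha_gt0 c2_gt0 feas Gsym Glo uL2 xsol.
have [HL2 ->] := eq_L2 hz zL2.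
by split=> //; rewrite (x_at0 xsol) in zle.
Qed.
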